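(* Let $\tilde f=(E,F,f)$ be a triple and let $k\in\{0,1,2,\ldots\}\cup\{\infty\}$. Then $\tilde f\in\mathcal D^k_{\rm Seip}$ if and only if one of the following holds: (a) $k=0$, $E,F\in\mathrm{scgVS}$, $f$ is a function with values in $F$, $\mathrm{dom}\,f\in\tau_E$, and $f$ is continuous $\tau_E\to\tau_F$; (b) $k=1$ and $f:E\supseteq\mathrm{dom}\,f\to F$ is continuously differentiable in Seip's sense; (c) $2\le k<\infty$ and $f:E\supseteq\mathrm{dom}\,f\to F$ is $k$ times continuously differentiable in Seip's sense; (d) $k=\infty$ and $f:E\supseteq\mathrm{dom}\,f\to F$ is infinitely often continuously differentiable in Seip's sense.
   Context: Spaces. ''Compact'' means every open cover has a finite subcover. For a topology $\mathcal T$ on a set $X$, its Kelleyfication $k\mathcal T$ is the set of all $U\subseteq X$ such that for every $\mathcal T$-compact $K$ there is $V\in\mathcal T$ with $U\cap K=V\cap K$. $\mathcal T$ is compactly generated if it is Hausdorff and $k\mathcal T=\mathcal T$. Put $\mathcal T\times_k\mathcal U=k(\mathcal T\times\mathcal U)$. A real topologized vector space $E$ is a real vector space with a topology $\tau_E$ (no compatibility required). $\mathrm{cgVS}$ is the class of those $E$ with $\tau_E$ compactly generated, addition continuous $\tau_E\times_k\tau_E\to\tau_E$, and scalar multiplication continuous $\tau_{\mathbb R}\times\tau_E\to\tau_E$. $\mathrm{scgVS}$ is the class of $E\in\mathrm{cgVS}$ such that some topology $\mathcal U$ makes the vector space $E$ a sequentially complete Hausdorff locally convex space with $\tau_E=k\,\mathcal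 U$. $E\sqcap_kF$ is the product vector space with topology $\tau_E\times_k\tau_F$. $\mathcal L_{cg}(E,F)$ is the vector space of continuous linear maps $E\to F$ with the subspace topology inherited from $k\mathcal T_{co}$, where $\mathcal T_{co}$ is the compact-open topology on the set of all continuous functions $\tau_E\to\tau_F$. The classes $\mathcal D^k_{\rm Seip}$. A partial function $f$ from $E$ to $F$ is a function with $\mathrm{dom}\,f\subseteq E$ and values in $F$. $\mathcal C_0$ is the class of triples $(E,F,f)$ with $E,F\in\mathrm{scgVS}$ and $f$ a partial function from $E$ to $F$ which is continuous with open domain. For $\tilde f=(E,F,f)$ with $E,F\in\mathrm{scgVS}$ and $f$ a partial function with open domain, the Seip-variation is $\delta\tilde f=(E\sqcap_kE,F,g)$, where $g(x,u)=\lim_{0\ne t\to0}t^{-1}(f(x+tu)-f(x))$ in $\tau_F$, defined at exactly those $(x,u)\in\mathrm{dom}\,f\times E$ for which the limit exists. $\tilde f$ is Seip differentiable if $\tilde f,\delta\tilde f\in\mathcal C_0$ and $\mathrm{dom}\,f\times E\subseteq\mathrm{dom}\,g$. $\mathcal D^k_{\rm Seip}$ is the class of $\tilde f$ for which there is a sequence $(\tilde f_i)$ in $\mathcal C_0$, indexed by $0\le i\le k$ (all $i\in\{0,1,\ldots\}$ if $k=\infty$), with $\tilde f_0=\tilde f$ and, for all finite $i<k$, $\tilde f_i$ Seip differentiable and $\tilde f_{i+1}=\delta\tilde f_i$. Seip's original notions. $f:E\supseteq U=\mathrm{dom}\,f\to F$ is continuously differentiable in Seip's sense if $E,F\in\mathrm{scgVS}$,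 $U\in\tau_E$, $f$ is a function $U\to F$, and, with $U_3=\{(x,u,t):x\in U,\ u\in E,\ t\in\mathbb R,\ x+tu\in U\}$, there are a function $f_1:U\to\mathcal L_{cg}(E,F)$ continuous $\tau_E\to\tau_{\mathcal L_{cg}(E,F)}$ and a function $h:U_3\to F$ continuous with respect to the topology of $(E\sqcap_kE)\sqcap_k\mathbb R$ on its source and $\tau_F$, such that $h(x,u,0)=0$ for all $x\in U,u\in E$, and $f(x+tu)=f(x)+f_1(x)(tu)+t\,h(x,u,t)$ for all $(x,u,t)\in U_3$. Then $f_1$ is uniquely determined ($f_1(x)(u)=\lim_{0\ne t\to 0}t^{-1}(f(x+tu)-f(x))$) and is called the derivative of $f$. One time continuously differentiable means continuously differentiable; for $k\ge2$ finite, $f:E\supseteq U\to F$ is $k$ times continuously differentiable if it is continuously differentiable and its derivative $f_1:E\supseteq U\to\mathcal L_{cg}(E,F)$ is $k-1$ times continuously differentiable (note that $\mathcal L_{cg}(E,F)\in\mathrm{scgVS}$). $f$ is infinitely often continuously differentiable if it is $k$ times continuously differentiable for every finite $k\ge1$. *)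

(* Defs.v *)
From HB Require Import structures.
From mathcomp Require Import all_boot all_order all_algebra.
From mathcomp Require Import all_classical all_reals.
From mathcomp Require Import topology normedtype convex.

Set Implicit Arguments.
Unset Strict Implicit.
Unset Printing Implicit Defensive.

Import Order.TTheory GRing.Theory Num.Theory.
Import numFieldTopology.Exports numFieldNormedType.Exports.

Local Open Scope classical_set_scope.
Local Open Scope ring_scope.

Section Kelleyfication.
Variable T : topologicalType.

Definition kopen : set_system T := [set U | forall K : set T, compact K ->
  exists2 V, open V & U `&` K = V `&` K].

Lemma kopenT : kopen [set: T].
Proof. by move=> K _; exists setT => //; exact: openT. Qed.

Lemma kopenI : setI_closed kopen.
Proof.
move=> A B kA kB K cK; have [V oV AV] := kA K cK; have [W oW BW] := kB K cK.
exists (V `&` W); first exact: openI.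
by rewrite setIIl AV BW -setIIl.
Qed.

Lemma kopen_bigU (I : Type) (f : I -> set T) :
  (forall i, kopen (f i)) -> kopen (\bigcup_i f i).
Proof.
move=> kf K cK.
have /choice[V VP] : forall i, exists V, open V /\ f i `&` K = V `&` K.
  by move=> i; have [V oV fV] := kf i K cK; exists V.
exists (\bigcup_i V i); first by apply: bigcup_open => i _; case: (VP i).
rewrite !setI_bigcupl; apply: eq_bigcupr => i _; by case: (VP i).
Qed.

End Kelleyfication.

(* [kelley T] is the set [T] with the topology [k T].  It is convertible to [T],
   so a function on [T] can be read as a function on [kelley T]; the type
   ascribed to its source decides which topology is meant by continuity. *)
Definition kelley (T : Type) : Type := T.

HB.instance Definition _ (T : choiceType) := Choice.copy (kelley T) T.
HB.instance Definition _ (T : topologicalType) :=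
  @isOpenTopological.Build (kelley T) (@kopen T) (@kopenT T) (@kopenI T)
    (@kopen_bigU T).
HB.instance Definition _ (R : numDomainType) (E : lmodType R) :=
  GRing.Lmodule.copy (kelley E) E.
HB.instance Definition _ (R : numDomainType) (E : preTopologicalLmodType R) :=
  GRing.Lmodule.on (kelley E).
HB.instance Definition _ (R : numDomainType) (E F : preTopologicalLmodType R) :=
  GRing.Lmodule.on (E * F)%type.

Definition compactly_generated (T : topologicalType) :=
  hausdorff_space T /\ @kopen T = @open T.

Lemma kelley_openE (T : topologicalType) : @open (kelley T) = @kopen T.
Proof. by []. Qed.

Lemma kelley_continuous (S T : topologicalType) (f : S -> T) :
  continuous f -> continuous (f : kelley S -> kelley T).
Proof.
move=> cf; apply/continuousP => U; rewrite !kelley_openE => kU K cK.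
have cfK : compact (f @` K).
  by apply: continuous_compact cK; exact: continuous_subspaceT.
have [V oV UV] := kU _ cfK; exists (f @^-1` V); first by move/continuousP: cf; exact.
rewrite predeqE => x; split=> -[fx Kx]; split=> //.
  by have [] : (V `&` f @` K) (f x) by rewrite -UV; split=> //; exists x.
by have [] : (U `&` f @` K) (f x) by rewrite UV; split=> //; exists x.
Qed.

(* A real topologized vector space is a [preTopologicalLmodType R]: a vector
   space and a topology, with no compatibility between the two. *)

Section Spaces.
Variable R : realType.
Implicit Types E F : preTopologicalLmodType R.

(* The product vector space with the topology [k (tau_E x tau_F)]. *)
Definition kprod E F : preTopologicalLmodType R := kelley (E * F)%type.

Definition cgVS E : Prop :=
  [/\ compactly_generated E,
      continuous (fun z : kprod E E => z.1 + z.2 : E) &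
      continuous (fun z : R^o * E => z.1 *: z.2 : E)].

(* The first three clauses are the axioms of [tvsType], stated for a topology
   which is not a canonical one. *)
Definition seq_complete_hausdorff_lcs E : Prop :=
  [/\ continuous (fun z : E * E => z.1 + z.2 : E),
      continuous (fun z : R^o * E => z.1 *: z.2 : E),
      exists2 B : set_system E, (forall b, b \in B -> convex_set b) & basis B,
      hausdorff_space E &
      forall u : nat -> E,
        (forall W : set E, nbhs (0 : E) W -> exists N : nat, forall m n : nat,
          (N <= m)%N -> (N <= n)%N -> W (u m - u n)) ->
        exists l : E, u @ \oo --> l].

End Spaces.

Record topology_on (T : Type) := TopologyOn {
  opens : set_system T ;
  opensT : opens setT ;
  opensI : setI_closed opens ;
  opens_bigU : forall (I : Type) (f : I -> set T),
    (forall i, opens (f i)) -> opens (\bigcup_i f i) }.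

(* For a topologized vector space [E], [retopologize U] is the vector space [E]
   with its own topology discarded and replaced by [U]. *)
Definition retopologize (T : Type) (U : topology_on T) : Type := T.

HB.instance Definition _ (R : numDomainType) (E : lmodType R)
  (U : topology_on E) := GRing.Lmodule.copy (retopologize U) E.
HB.instance Definition _ (R : numDomainType) (E : lmodType R)
    (U : topology_on E) :=
  @isOpenTopological.Build (retopologize U) (opens U) (opensT U) (@opensI _ U)
    (@opens_bigU _ U).

Definition scgVS (R : realType) (E : preTopologicalLmodType R) : Prop :=
  cgVS E /\ exists U : topology_on E,
    seq_complete_hausdorff_lcs (retopologize U) /\
    @open E = @kopen (retopologize U).

(* The library puts the compact-open topology on all functions; [cts_co] is its
   subspace of continuous functions. *)
Definition cts_co (S T : topologicalType) : Type :=
  initial_topology (id : continuousType S T -> {compact-open, S -> T}).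
HB.instance Definition _ (S T : topologicalType) :=
  Topological.copy (cts_co S T)
    (initial_topology (id : continuousType S T -> {compact-open, S -> T})).

Section ContinuousLinear.
Variables (R : realType) (E F : preTopologicalLmodType R).

Definition clin : pred (E -> F) := fun f => `[< linear f /\ continuous f >].

Lemma clinP f : reflect (linear f /\ continuous f) (f \in clin).
Proof. exact: asboolP. Qed.

Hypotheses (hE : cgVS E) (hF : cgVS F).

Lemma clin_submod : submod_closed clin.
Proof.
have [[_ kE] _ _] := hE; have [_ addF scaleF] := hF.
split=> [|a f g /clinP[lf cf] /clinP[lg cg]].
  apply/clinP; split=> [a x y|]; last exact: cst_continuous.
  by rewrite scaler0 addr0.
apply/clinP; split=> [b x y|].
  rewrite !fctE /= lf lg !scalerDr !scalerA (mulrC a b) -!addrA; congr (_ + _).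
  by rewrite addrCA.
have caf : continuous (fun x => a *: f x : F).
  move=> x; apply: (@continuous_comp _ (R^o * F)%type _
    (fun x => (a, f x) : R^o * F) (fun z => z.1 *: z.2)); last exact: scaleF.
  apply: (@cvg_pair _ _ _ _ (nbhs (a : R^o))); [exact: cvg_cst|exact: cf].
have cp : continuous (fun x => (a *: f x, g x) : F * F).
  by move=> x; apply: cvg_pair; [exact: caf|exact: cg].
have cs := kelley_continuous cp.
apply/continuousP => U oU; rewrite -kE.
have : open ((fun z : kprod F F => z.1 + z.2 : F) @^-1` U).
  by move: U oU; apply/continuousP.
by move/continuousP: cs => /[apply].
Qed.

(* The hypotheses are needed only for the continuous linear maps to be closed
   under addition and scaling; neither the carrier nor the topology depends on
   them. *)
Definition Lcg : Type := let _ := (hE, hF) in {f : E -> F | clin f}.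

HB.instance Definition _ := SubChoice.copy Lcg {f : E -> F | clin f}.
HB.instance Definition _ := GRing.SubChoice_isSubLmodule.Build R (E -> F) clin Lcg
  (GRing.submod_closed_semi clin_submod).

Lemma Lcg_continuous (f : Lcg) : continuous (val f).
Proof. by case: f => f /= /asboolP[]. Qed.

(* The inclusion inducing the topology of [Lcg]; the Kelleyfication is taken on
   the space of all continuous functions, before restricting to linear maps. *)
Definition cts_of_Lcg (f : Lcg) : kelley (cts_co E F) :=
  mkcts (@Lcg_continuous f).

HB.instance Definition _ :=
  Topological.copy Lcg (initial_topology cts_of_Lcg).
End ContinuousLinear.

(* [f x = None] means that [x] lies outside the domain. *)
Definition pfun (S T : Type) := S -> option T.

Definition dom (S T : Type) (f : pfun S T) : set S := [set x | f x].

(* the value of [f] at [x], with the junk value 0 outside of the domain *)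
Definition pval (S : Type) (V : nmodType) (f : pfun S V) (x : S) : V :=
  odflt 0 (f x).

Record striple (R : realType) := STriple {
  src : preTopologicalLmodType R ;
  tgt : preTopologicalLmodType R ;
  pf : pfun src tgt }.
Arguments STriple {R} src tgt pf.
Arguments pf {R} s.

Section Seip.
Variable R : realType.
Implicit Types (E F : preTopologicalLmodType R) (ft : striple R).

Definition pcontinuous E F (f : pfun E F) := {within dom f, continuous (pval f)}.

Definition C0 ft : Prop :=
  [/\ scgVS (src ft), scgVS (tgt ft), open (dom (pf ft)) & pcontinuous (pf ft)].

(* The difference quotient is only defined for [x + t *: u] in [dom f], hence the
   [within]. *)
Definition is_dirderiv E F (f : pfun E F) (x u : E) (l : F) : Prop :=
  (fun t : R^o => t^-1 *: (pval f (x + t *: u) - pval f x)) @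
    within [set t | dom f (x + t *: u)] (0 : R^o)^' --> l.

(* [xget] picks the limit, which is unique when [E] and [F] are in scgVS and
   [dom f] is open. *)
Definition variation E F (f : pfun E F) : pfun (kprod E E) F := fun z =>
  if `[< dom f z.1 /\ exists l, is_dirderiv f z.1 z.2 l >]
  then Some (xget 0 [set l | is_dirderiv f z.1 z.2 l]) else None.

Definition seip_variation ft : striple R :=
  STriple (kprod (src ft) (src ft)) (tgt ft) (variation (pf ft)).

Definition seip_differentiable ft : Prop :=
  [/\ C0 ft, C0 (seip_variation ft) &
      dom (pf ft) `*` setT `<=` dom (variation (pf ft))].

End Seip.

(* The exponents [k] in {0, 1, 2, ...} U {oo}. *)
Inductive smoothness := Fin of nat | Infty.

Definition le_smooth (i : nat) (k : smoothness) : bool :=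
  if k is Fin n then (i <= n)%N else true.
Definition lt_smooth (i : nat) (k : smoothness) : bool :=
  if k is Fin n then (i < n)%N else true.

(* Only the terms [s i] with [i <= k] matter. *)
Definition DSeip (R : realType) (k : smoothness) (ft : striple R) : Prop :=
  exists s : nat -> striple R,
    [/\ forall i, le_smooth i k -> C0 (s i),
        s 0%N = ft &
        forall i, lt_smooth i k ->
          seip_differentiable (s i) /\ s i.+1 = seip_variation (s i)].

Section Original.
Variable R : realType.
Implicit Types E F : preTopologicalLmodType R.

(* A point of [U3 f] is [((x, u), t)]. *)
Definition U3 E F (f : pfun E F) : set (kprod (kprod E E) R^o) :=
  [set z | dom f z.1.1 /\ dom f (z.1.1 + z.2 *: z.1.2)].

(* [f1] is the derivative of [f].  The remainder [h] is a total function of which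
   only the restriction to [U3 f] matters. *)
Definition seip_derivative E F (hE : cgVS E) (hF : cgVS F) (f : pfun E F)
    (f1 : pfun E (Lcg hE hF)) : Prop :=
  [/\ scgVS E, scgVS F & open (dom f)] /\
  [/\ dom f1 = dom f, pcontinuous f1 &
    exists h : kprod (kprod E E) R^o -> F,
    [/\ {within U3 f, continuous h},
        forall x u, dom f x -> h (x, u, 0) = 0 &
        forall x u (t : R), U3 f (x, u, t) ->
          pval f (x + t *: u)
            = pval f x + val (pval f1 x) (t *: u) + t *: h (x, u, t)]].

Definition cont_diff E F (f : pfun E F) : Prop :=
  exists (hE : cgVS E) (hF : cgVS F) (f1 : pfun E (Lcg hE hF)),
    seip_derivative f f1.

(* [k] times continuously differentiable is only defined for [1 <= k] *)
Fixpoint times_cont_diff (k : nat) E F (f : pfun E F) : Prop :=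
  match k with
  | 0%N => False
  | 1%N => cont_diff f
  | S (S _ as m) =>
      exists (hE : cgVS E) (hF : cgVS F) (f1 : pfun E (Lcg hE hF)),
        seip_derivative f f1 /\ times_cont_diff m f1
  end.

Definition inf_cont_diff E F (f : pfun E F) : Prop :=
  forall k : nat, (1 <= k)%N -> times_cont_diff k f.

End Original.

(* Main.v *)
Require Import Defs.
From mathcomp Require Import all_boot all_order all_algebra.
From mathcomp Require Import all_classical all_reals.
From mathcomp Require Import topology normedtype convex interval_inference.

(** The whole proof rests on one fact and one law.

    The fact ([diffq_cts_on]): if [f] is continuous on an open set and has a jointly
    continuous variation [df], then the difference quotient of [f], completed by [df]
    at [t = 0], is jointly continuous in [(x, u, t)].  Indeed the mean value theorem
    traps the difference quotient in any convex set that is a neighbourhood of the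
    values of [df] along the secant; this gives continuity for the locally convex
    topology of which the topology of [F] is the Kelleyfication, and a map from a
    k-space that is continuous for a topology is continuous for its Kelleyfication.
    Consequently [df] is linear in the direction ([dirder_linear]), and the remainder
    that Seip asks for is the completed difference quotient minus [df].  Conversely, a
    continuous remainder gives back the directional derivatives.

    The law ([Lcg_ev], [Lcg_curry]): a map from a k-space to the space of continuous
    linear maps is continuous if and only if the uncurried map is continuous on the
    k-product.  With the fact above this settles one order of differentiability.  For
    higher orders it is lifted to maps of class n ([Cn_uncurry], [Cn_curry]), by
    induction on n and with all spaces varying: the product rule in one direction,
    partial derivatives in the other.  Since the variation of [f] is the uncurried
    derivative, the recursion on variations and the recursion on derivatives then
    describe the same functions ([iterated_seipE], [times_cont_diffE]).

    The recursions stay inside the class scgVS because it is stable under k-products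
    ([scgVS_kprod]) and under the formation of spaces of continuous linear maps
    ([scgVS_Lcg]).  For the latter, the locally convex topology is uniform convergence
    on compact sets; it is sequentially complete because a function on a k-space which
    is continuous on compact sets is continuous. *)

Set Implicit Arguments.
Unset Strict Implicit.
Unset Printing Implicit Defensive.

Import Order.TTheory GRing.Theory Num.Theory.
Import numFieldTopology.Exports numFieldNormedType.Exports.

Local Open Scope classical_set_scope.
Local Open Scope ring_scope.

(** * Functions continuous on an open set *)

(** Taking [O := setT] shows that [D] is open, so this is continuity of [f] at every
    point of an open set [D].  Phrased with open sets only, it applies directly to
    k-topologies, whose open sets are explicit while their neighbourhoods are not. *)
Definition cts_on (X Y : topologicalType) (D : set X) (f : X -> Y) :=
  forall O, open O -> open (D `&` f @^-1` O).

Section CtsOn.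
Variables X Y Z : topologicalType.
Implicit Types (D : set X) (f : X -> Y).

Lemma cts_on_open D f : cts_on D f -> open D.
Proof. by move=> /(_ _ openT); rewrite preimage_setT setIT. Qed.

Lemma cts_on_near D f x : cts_on D f -> D x -> {for x, continuous f}.
Proof.
move=> cf Dx W; rewrite nbhsE => -[O [oO Ofx] OW]; apply: filterS (_ : nbhs x (D `&` f @^-1` O)).
  by move=> y [_ /OW].
by apply: open_nbhs_nbhs; split=> //; exact: cf.
Qed.

Lemma cts_onI D f : open D -> (forall x, D x -> {for x, continuous f}) -> cts_on D f.
Proof.
move=> oD cf O oO; rewrite openE => x [Dx Ofx]; apply: filterI; first exact: open_nbhs_nbhs.
by apply: cf => //; exact: open_nbhs_nbhs.
Qed.

Lemma cts_on_within D f : open D -> {within D, continuous f} <-> cts_on D f.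
Proof.
move=> oD; rewrite continuous_open_subspace//; split=> [cf|cf x /set_mem Dx].
  by apply: cts_onI => // x Dx; apply: cf; exact: mem_set.
exact: cts_on_near cf Dx.
Qed.

Lemma cts_onT f : cts_on setT f <-> continuous f.
Proof.
split=> [cf x|/continuousP cf O oO]; first exact: cts_on_near cf _.
by rewrite setTI; exact: cf.
Qed.

Lemma cts_on_sub D D' f : cts_on D f -> open D' -> D' `<=` D -> cts_on D' f.
Proof.
by move=> cf oD' D'D; apply: cts_onI => // x /D'D; exact: cts_on_near.
Qed.

Lemma eq_cts_on D f g : (forall x, D x -> f x = g x) -> cts_on D f -> cts_on D g.
Proof.
move=> fg cf O /cf; congr open; rewrite predeqE => x.
by split=> -[Dx]; rewrite /preimage/= ?fg// -?fg.
Qed.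

Lemma cts_on_cst D (y : Y) : open D -> cts_on D (fun=> y).
Proof. by move=> oD; apply: cts_onI => // x _; exact: cst_continuous. Qed.

Lemma cts_on_id D : open D -> cts_on D (fun x => x).
Proof. by move=> oD O oO; exact: openI. Qed.

End CtsOn.

Lemma cts_on_pair (X Y Z : topologicalType) (D : set X) (f : X -> Y) (g : X -> Z) :
  cts_on D f -> cts_on D g -> cts_on D (fun x => (f x, g x)).
Proof.
move=> cf cg; apply: cts_onI; first exact: cts_on_open cf.
move=> x Dx; apply: cvg_pair; [exact: (cts_on_near cf Dx)|exact: (cts_on_near cg Dx)].
Qed.

Lemma cts_on_comp (X Y Z : topologicalType) (D : set X) (D' : set Y)
    (f : X -> Y) (g : Y -> Z) :
  cts_on D f -> cts_on D' g -> (forall x, D x -> D' (f x)) ->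
  cts_on D (fun x => g (f x)).
Proof.
move=> cf cg DD' O /cg /cf; congr open; rewrite predeqE => x.
by split=> [[Dx [_ ]]//|[Dx Ogfx]]; split=> //; split=> //; exact: DD'.
Qed.

Lemma cts_on_compl (X Y Z : topologicalType) (D : set X) (f : X -> Y) (g : Y -> Z) :
  continuous g -> cts_on D f -> cts_on D (fun x => g (f x)).
Proof. by move=> /cts_onT cg cf; exact: (cts_on_comp cf cg). Qed.

Lemma cts_on_compr (X Y Z : topologicalType) (D : set Y) (f : X -> Y) (g : Y -> Z) :
  continuous f -> cts_on D g -> cts_on (f @^-1` D) (fun x => g (f x)).
Proof.
move=> /continuousP cf cg; apply: (cts_on_comp _ cg) => // O oO.
by rewrite -preimage_setI; apply/cf/openI => //; exact: cts_on_open cg.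
Qed.

(** * k-spaces *)

Section Kspaces.
Implicit Types X Y T : topologicalType.

(** Being trace-open on a compact set can be checked locally, by taking unions. *)
Lemma kopenP T (W : set T) :
  (forall K z, compact K -> K z -> W z ->
     exists V, [/\ open V, V z & V `&` K `<=` W]) -> kopen W.
Proof.
move=> h K cK.
exists (\bigcup_(V in [set V : set T | open V /\ V `&` K `<=` W]) V).
  by apply: bigcup_open => V [].
rewrite predeqE => z; split=> [[Wz Kz]|[[V [oV VW] Vz] Kz]].
  by have [V [oV Vz VW]] := h K z cK Kz Wz; split=> //; exists V.
by split=> //; apply: VW.
Qed.

Lemma open_kopen T (U : set T) : open U -> kopen U.
Proof. by move=> oU K _; exists U. Qed.

Lemma kelley_id T : continuous (fun x : kelley T => x : T).
Proof. by apply/continuousP => U oU; exact: open_kopen. Qed.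

(** On a compact [K] the two topologies have the same traces, so a covering of [K]
    for the finer one is also a covering for the coarser one. *)
Lemma kelley_compact T (K : set T) : compact (K : set (kelley T)) <-> compact K.
Proof.
split=> [cK|/compact_near_coveringP/near_covering_withinP cK].
  rewrite -[K]image_id; apply: (@continuous_compact (kelley T) T id) cK.
  by apply: continuous_subspaceT; exact: kelley_id.
have cK0 : compact K by apply/compact_near_coveringP/near_covering_withinP.
apply/compact_near_coveringP/near_covering_withinP => I F P FF cov.
apply: cK => x Kx; have [[A B] /= [nA FB] AB] := cov x Kx.
have := nA; rewrite nbhsE => -[O [kO Ox] OA].
have [V oV OV] := kO K cK0.
have [Vx _] : (V `&` K) x by rewrite -OV.
exists (V, B) => /=; first by split=> //; exact: open_nbhs_nbhs.
move=> [y i] /= [Vy Bi] Ky; apply: (AB (y, i)) => //; split=> //; apply: OA.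
by have [] : (O `&` K) y by rewrite OV.
Qed.

(** Kelleyfication is idempotent, because it does not change the compact sets. *)
Lemma kelley_kopen T : @kopen (kelley T) = @kopen T.
Proof.
rewrite predeqE => U; split=> [kU|kU]; last by apply: open_kopen; rewrite kelley_openE.
move=> K cK; have /kU[V kV UV] : compact (K : set (kelley T)) by apply/kelley_compact.
by have [W oW VW] := kV K cK; exists W => //; rewrite UV.
Qed.

Lemma hausdorff_inj X T (f : X -> T) :
  continuous f -> injective f -> hausdorff_space T -> hausdorff_space X.
Proof.
move=> cf injf hT x y xy; apply/injf/hT => A B nA nB.
by have [z [Az Bz]] := xy _ _ (cf x _ nA) (cf y _ nB); exists (f z).
Qed.

Lemma kelley_cg T : hausdorff_space T -> compactly_generated (kelley T).
Proof.
move=> hT; split; last exact: kelley_kopen.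
by apply: hausdorff_inj hT; [exact: kelley_id|].
Qed.

Lemma hausdorff_prod X Y :
  hausdorff_space X -> hausdorff_space Y -> hausdorff_space (X * Y)%type.
Proof.
move=> hX hY [x y] [x' y'] h; congr (_, _); [apply: hX|apply: hY] => A B nA nB.
  have [|| [a b] [/= Aa Ba]] := h (A `*` setT) (B `*` setT); last by exists a; case: Aa; case: Ba.
    by exists (A, setT) => //; split=> //; exact: filterT.
  by exists (B, setT) => //; split=> //; exact: filterT.
have [|| [a b] [/= Aa Ba]] := h (setT `*` A) (setT `*` B); last by exists b; case: Aa; case: Ba.
  by exists (setT, A) => //; split=> //; exact: filterT.
by exists (setT, B) => //; split=> //; exact: filterT.
Qed.

(** A compact Hausdorff space is locally compact.  This replaces local compactness of
    the ambient space, which fails for infinite-dimensional spaces: every argument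
    below is carried out on the trace of a compact set. *)
Lemma compact_shrink T (K P : set T) (x : T) :
  hausdorff_space T -> compact K -> K x -> open P -> P x ->
  exists V C, [/\ open V, V x, compact C & V `&` K `<=` C /\ C `<=` P `&` K].
Proof.
move=> hT cK Kx oP Px.
have clK := compact_closed hT cK.
have cKP : compact (K `\` P).
  by rewrite setDE; apply: compact_closedI => //; exact: open_closedC.
have /compact_near_coveringP cov := cKP.
have /(cov (set T) (powerset_filter_from (nbhs x)) (fun U a => ~ closure U a)) :
    forall a, (K `\` P) a -> \forall a' \near a & U \near powerset_filter_from (nbhs x),
      ~ closure U a'.
  move=> a [Ka nPa].
  have /eqP ax : x <> a by move=> xa; apply: nPa; rewrite -xa.
  have := hT; rewrite open_hausdorff => /(_ _ _ ax)[[A B] /= [/set_mem Ax /set_mem Ba] [oA oB AB]].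
  exists (B, [set W | nbhs x W /\ W `<=` A]) => /=.
    split; first exact: open_nbhs_nbhs.
    by apply: powerset_filter_fromP; exact: open_nbhs_nbhs.
  move=> [a' W] /= [Ba' [_ WA]] /(_ B); case; first exact: open_nbhs_nbhs.
  by move=> z [/WA Az Bz]; have : (A `&` B) z by []; rewrite (eqP AB).
move=> /near_powerset_filter_fromP[].
  by move=> U V UV h a /h ncl clU; apply: ncl; exact: closureS UV _ clU.
move=> U nU hU; exists (U^°)%classic, (closure U `&` K); split.
- exact: open_interior.
- exact: nU.
- by rewrite setIC; apply: compact_closedI => //; exact: closed_closure.
- split; first by apply: setSI; apply: subset_trans (@interior_subset _ _) (@subset_closure _ _).
  move=> y [cUy Ky]; split=> //; apply: contrapT => nPy.
  by apply: (hU y).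
Qed.

(** The image of a compact set on which [f] is continuous is compact, so a k-open set of
    the target has the same trace on it as an open set.  As the domain [D] is only open,
    a compact set is first shrunk around the given point to one contained in [D]. *)
Lemma kelley_lift_compactly X Y (D : set X) (f : X -> Y) :
  compactly_generated X -> open D ->
  (forall K, compact K -> K `<=` D -> {within K, continuous f}) ->
  cts_on D (f : X -> kelley Y).
Proof.
move=> [hX kX] oD cf O kO; rewrite -kX; apply: kopenP => K z cK Kz [Dz Ofz].
have [V [C [oV Vz cC [VC CD]]]] := compact_shrink hX cK Kz oD Dz.
have cfC : {within C, continuous f} by apply: cf => // y /CD[].
have Cz : C z by exact: VC.
have /kO[W oW OW] := continuous_compact cfC cC.
have [Wfz _] : (W `&` f @` C) (f z) by rewrite -OW; split=> //; exists z.
have nzW : nbhs z [set y | C y -> W (f y)].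
  have /subspace_continuousP/(_ z Cz) cfz := cfC.
  exact: (cfz W (open_nbhs_nbhs (conj oW Wfz))).
have := nzW; rewrite nbhsE => -[V' [oV' V'z] V'W].
exists (V `&` V'); split; first exact: openI.
  by [].
move=> y [[Vy V'y] Ky]; have Cy : C y by exact: VC.
split; first by have [] := CD _ Cy.
have [] // : (O `&` f @` C) (f y).
by rewrite OW; split; [exact: V'W|exists y].
Qed.

(** This universal property of the k-topology makes it possible to pair partial maps
    into k-products. *)
Lemma kelley_lift X Y (D : set X) (f : X -> Y) :
  compactly_generated X -> cts_on D f -> cts_on D (f : X -> kelley Y).
Proof.
move=> cX cf; apply: kelley_lift_compactly => //; first exact: cts_on_open cf.
move=> K _ KD; apply: continuous_subspaceW KD _.
by apply/cts_on_within => //; exact: cts_on_open cf.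
Qed.

(** The tube lemma survives Kelleyfication: over a compact [K], the set [O] has the same
    trace on [K `*` C] as an honest open set. *)
Lemma tube X Y (O : set (X * Y)) (C : set Y) :
  compact C -> kopen O -> kopen [set x | forall y, C y -> O (x, y)].
Proof.
move=> cC kO K cK; have [V oV OV] := kO _ (compact_setX cK cC).
exists [set x | forall y, C y -> V (x, y)].
  rewrite openE => x Vx; have /compact_near_coveringP cov := cC.
  apply: (cov X (nbhs x) (fun x y => V (x, y))) => y Cy.
  have : nbhs (x, y) V by apply: open_nbhs_nbhs; split=> //; exact: Vx.
  move=> [[A B] /= [nA nB] AB]; exists (B, A) => //= -[y' x'] /= [By Ax].
  exact: (AB (x', y')).
rewrite predeqE => x; split=> -[h Kx]; split=> // y Cy.
  by have [] : (V `&` K `*` C) (x, y) by rewrite -OV; split=> //; exact: h.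
by have [] : (O `&` K `*` C) (x, y) by rewrite OV; split=> //; exact: h.
Qed.

Lemma kopen_slice X Y (O : set (X * Y)) y : kopen O -> kopen [set x | O (x, y)].
Proof.
move=> kO; have := tube (@compact_set1 Y y) kO; congr kopen.
by rewrite predeqE => x; split=> [/(_ y erefl)//|h _ ->].
Qed.

Lemma cg_tube X Y (O : set (X * Y)) (C : set Y) :
  compactly_generated X -> compact C -> kopen O ->
  open [set x | forall y, C y -> O (x, y)].
Proof. by move=> [_ <-]; exact: tube. Qed.

End Kspaces.

Section RealLine.
Variable R : realType.

Lemma R_closed_ball_compact (x : R^o) :
  exists C : set R^o, compact C /\ nbhs x C.
Proof.
exists `[x - 1, x + 1]%classic; split; first exact: segment_compact.
apply: (@filterS _ _ _ `]x - 1, x + 1[%classic); first exact: subset_itv_oo_cc.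
apply: open_nbhs_nbhs; split; first exact: interval_open.
by rewrite /= in_itv/= ltrBlDr !ltrDl ltr01.
Qed.

Lemma R_cg : compactly_generated R^o.
Proof.
split; first exact: Rhausdorff.
rewrite predeqE => U; split=> [kU|]; last exact: open_kopen.
rewrite openE => x Ux; have [C [cC nC]] := R_closed_ball_compact x.
have [V oV UV] := kU C cC.
have [Vx _] : (V `&` C) x by rewrite -UV; split=> //; exact: nbhs_singleton nC.
have : nbhs x (V `&` C) by apply: filterI => //; exact: open_nbhs_nbhs.
by apply: filterS => y; rewrite -UV => -[].
Qed.

Lemma kopen_swap (X Y : topologicalType) (O : set (X * Y)) :
  kopen O -> kopen [set z : Y * X | O (z.2, z.1)].
Proof.
move=> kO; have cs : continuous (fun z : Y * X => (z.2, z.1)).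
  by move=> z; apply: cvg_pair; [exact: cvg_snd|exact: cvg_fst].
by have /continuousP/(_ O) := kelley_continuous cs; apply.
Qed.

(** The scalars are locally compact: a compact set with interior fits in the slice of a
    k-open set through a given point, and the tube lemma applied to this compact set
    provides the other factor. *)
Lemma R_prod_cg (X : topologicalType) : compactly_generated X ->
  @kopen (R^o * X)%type = @open (R^o * X)%type.
Proof.
move=> cX; rewrite predeqE => O; split=> [kO|]; last exact: open_kopen.
rewrite openE => -[t x] Otx.
have : open [set s : R^o | O (s, x)].
  by rewrite -(proj2 R_cg); exact: kopen_slice.
move=> oS.
have [V [C [oV Vt cC [VC CS]]]] : exists V C : set R^o,
    [/\ open V, V t, compact C & V `<=` C /\ C `<=` [set s : R^o | O (s, x)]].
  have [C0 [cC0 nC0]] := R_closed_ball_compact t.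
  have [V [C [oV Vt cC [VC CS]]]] :=
    compact_shrink (proj1 R_cg) cC0 (nbhs_singleton nC0) oS Otx.
  exists (V `&` C0^°)%classic, C; split=> //.
  - by apply: openI => //; exact: open_interior.
  - split; first by move=> s [Vs /interior_subset Cs]; exact: VC.
    by move=> s /CS[].
have oW : open [set y | forall s, C s -> O (s, y)] := cg_tube cX cC (kopen_swap kO).
exists (V, [set y | forall s, C s -> O (s, y)]) => /=.
  split; apply: open_nbhs_nbhs; split=> //.
by move=> [s y] /= [Vs]; apply; exact: VC.
Qed.

End RealLine.

(** * Vector operations along k-continuous maps *)

Section VectorCts.
Variable R : realType.
Implicit Types (X : topologicalType) (E F : preTopologicalLmodType R).

Lemma kprod_cg E F : hausdorff_space E -> hausdorff_space F ->
  compactly_generated (kprod E F).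
Proof. by move=> hE hF; apply: kelley_cg; exact: hausdorff_prod. Qed.

Lemma kfst E F : continuous (fun z : kprod E F => z.1 : E).
Proof.
apply/cts_onT; apply: (@cts_on_compl _ (E * F)%type _ _ _ fst).
  by move=> z; exact: cvg_fst.
by apply/cts_onT; exact: kelley_id.
Qed.

Lemma ksnd E F : continuous (fun z : kprod E F => z.2 : F).
Proof.
apply/cts_onT; apply: (@cts_on_compl _ (E * F)%type _ _ _ snd).
  by move=> z; exact: cvg_snd.
by apply/cts_onT; exact: kelley_id.
Qed.

Lemma cts_on_kpair X E F (D : set X) (f : X -> E) (g : X -> F) :
  compactly_generated X -> cts_on D f -> cts_on D g ->
  @cts_on X (kprod E F) D (fun x => (f x, g x)).
Proof. by move=> cX cf cg; apply: kelley_lift => //; exact: cts_on_pair. Qed.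

Lemma cts_onD X F (D : set X) (f g : X -> F) :
  cgVS F -> compactly_generated X -> cts_on D f -> cts_on D g ->
  cts_on D (fun x => f x + g x).
Proof.
move=> [_ addF _] cX cf cg.
exact: (@cts_on_compl _ (kprod F F) _ _ (fun x => (f x, g x))
  (fun z : kprod F F => z.1 + z.2 : F) addF (cts_on_kpair cX cf cg)).
Qed.

Lemma cts_onZ X F (D : set X) (a : X -> R^o) (f : X -> F) :
  cgVS F -> cts_on D a -> cts_on D f -> cts_on D (fun x => a x *: f x).
Proof.
move=> [_ _ scF] ca cf.
exact: (@cts_on_compl _ (R^o * F)%type _ _ (fun x => (a x, f x))
  (fun z : R^o * F => z.1 *: z.2 : F) scF (cts_on_pair ca cf)).
Qed.

Lemma cts_onB X F (D : set X) (f g : X -> F) :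
  cgVS F -> compactly_generated X -> cts_on D f -> cts_on D g ->
  cts_on D (fun x => f x - g x).
Proof.
move=> hF cX cf cg; apply: cts_onD => //.
apply: (eq_cts_on (f := fun x => -1 *: g x)) => [x _|]; first by rewrite scaleN1r.
by apply: cts_onZ => //; apply: cts_on_cst; exact: cts_on_open cf.
Qed.

End VectorCts.

(** * Evaluation and currying for continuous linear maps *)

Section LcgTopology.
Variables (R : realType) (E F : preTopologicalLmodType R).
Variables (hE : cgVS E) (hF : cgVS F).
Local Notation L := (Lcg hE hF).

Lemma Lcg_linear (g : L) : linear (val g).
Proof. by case: g => g /= /asboolP[]. Qed.

Lemma Lcg_open (C : set E) (O : set F) : compact C -> open O ->
  open [set g : L | val g @` C `<=` O].
Proof.
move=> cC oO; exists [set g : kelley (cts_co E F) | (g : E -> F) @` C `<=` O] => //.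
apply: open_kopen; exists [set g : {compact-open, E -> F} | g @` C `<=` O] => //.
exact: compact_open_open.
Qed.

(** On a compact set [K] of pairs, the second components range over a compact set, in
    which a point has compact neighbourhoods [C]; on those, membership in the
    subbasic set of all [g] with [g @` C `<=` O] controls the values [g u]. *)
Lemma Lcg_ev : continuous (fun z : kprod L E => val z.1 z.2 : F).
Proof.
apply/continuousP => O oO; apply: kopenP => K [g u] cK Kgu Ogu.
have cK2 : compact (snd @` K).
  apply: continuous_compact cK; apply: continuous_subspaceT => z; exact: cvg_snd.
have K2u : (snd @` K) u by exists (g, u).
have oP : open (val g @^-1` O) by move: O oO {Ogu}; apply/continuousP; exact: Lcg_continuous.
have [[hausE _] _ _] := hE.
have [V [C [oV Vu cC [VC CP]]]] := compact_shrink hausE cK2 K2u oP Ogu.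
exists ([set g : L | val g @` C `<=` O] `*` V); split.
- rewrite openE => -[g' u'] [/= h Vu'].
  exists ([set g : L | val g @` C `<=` O], V) => //=; split; apply: open_nbhs_nbhs; split=> //.
  exact: Lcg_open.
- by split=> //= _ [y /CP[Oy _] <-].
- move=> [g' u'] [[/= h Vu'] Kgu']; apply: h; exists u' => //; apply: VC; split=> //.
  by exists (g', u').
Qed.

Lemma cts_on_ev (X : topologicalType) (D : set X) (g : X -> L) (u : X -> E) :
  compactly_generated X -> cts_on D g -> cts_on D u ->
  cts_on D (fun x => val (g x) (u x)).
Proof.
move=> cX cg cu.
exact: (@cts_on_compl _ (kprod L E) _ _ (fun x => (g x, u x))
  (fun z : kprod L E => val z.1 z.2) Lcg_ev (cts_on_kpair cX cg cu)).
Qed.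

(** Exponential law, from the product to the function space: continuity into the
    compact-open topology is the tube lemma, and the source being a k-space lifts it
    to the Kelleyfication. *)
Lemma Lcg_curry (X : topologicalType) (D : set X) (c : X * E -> F) (g : X -> L) :
  compactly_generated X -> @cts_on (kelley (X * E)) F [set z | D z.1] c ->
  (forall x u, D x -> val (g x) u = c (x, u)) -> cts_on D g.
Proof.
move=> cX cc gc.
have oD : open D.
  by have := kopen_slice 0 (cts_on_open cc); rewrite (proj2 cX).
have h1 : @cts_on X {compact-open, E -> F} D (fun x => val (g x)).
  apply: cts_onI => // x Dx; apply/compact_open_cvgP => K O cK oO gO.
  have oT := cg_tube cX cK (cc _ oO).
  apply: filterS (open_nbhs_nbhs (conj oT _)) => /=.
    by move=> y h _ [u Ku <-]; have [/= Dy] := h u Ku; rewrite gc.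
  by move=> u Ku; split=> //; rewrite /preimage/= -gc//; apply: gO; exists u.
have h2 : @cts_on X (cts_co E F) D (fun x => mkcts (@Lcg_continuous _ _ _ _ _ (g x))).
  by move=> O [B oB <-]; exact: h1.
have h3 := kelley_lift cX h2.
by move=> O [B oB <-]; exact: h3.
Qed.

End LcgTopology.

(** * Compactly generated spaces of continuous linear maps *)

Lemma eq_at_closure (X T : topologicalType) (f g : X -> T) (S : set X) (x : X) :
  hausdorff_space T -> {for x, continuous f} -> {for x, continuous g} ->
  closure S x -> (forall y, S y -> f y = g y) -> f x = g x.
Proof.
move=> hT cf cg Sx fg; apply: hT => A B nA nB.
have nfg : nbhs x (f @^-1` A `&` g @^-1` B).
  by apply: filterI; [exact: cf|exact: cg].
have [y [Sy [Ay By]]] := Sx _ nfg.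
by exists (f y); split=> //; rewrite (fg _ Sy).
Qed.

Lemma closed_equalizer (X T : topologicalType) (f g : X -> T) :
  hausdorff_space T -> continuous f -> continuous g -> closed [set x | f x = g x].
Proof.
move=> hT cf cg x Sx.
exact: (eq_at_closure hT (cf x) (cg x) Sx).
Qed.

(** The inducing map is an embedding, so its inverse on the image is continuous. *)
Lemma compact_initial (S : choiceType) (T : topologicalType) (f : S -> T) (A : set T) :
  A `<=` range f -> compact A -> compact (f @^-1` A : set (initial_topology f)).
Proof.
move=> Af cA F PF FA.
have [y [Ay cly]] := cA (f @ F) _ FA.
have [x _ fx] := Af y Ay; exists x; split; first by rewrite /preimage/= fx.
move=> B U FB [_ [[O oO <-] Ox OU]].
have nO : nbhs y O by apply: open_nbhs_nbhs; split=> //; rewrite -fx.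
have [_ [[b Bb <-] Ofb]] := cly (f @` B) O (filterS (@preimage_image _ _ f B) FB) nO.
by exists b; split=> //; exact: OU.
Qed.

Section CgVS.
Variable R : realType.
Implicit Types E F : preTopologicalLmodType R.

Lemma cgVS_cg E : cgVS E -> compactly_generated E. Proof. by case. Qed.
Lemma cgVS_hausdorff E : cgVS E -> hausdorff_space E. Proof. by case=> -[]. Qed.

(** By [R_prod_cg], the k-product of the scalars with [E] is the plain product. *)
Lemma cgVS_intro E : compactly_generated E ->
  continuous (fun z : kprod E E => z.1 + z.2 : E) ->
  continuous (fun z : kelley (R^o * E)%type => z.1 *: z.2 : E) -> cgVS E.
Proof.
move=> cE addE scE; split=> //; apply/continuousP => O oO.
by rewrite -(R_prod_cg R cE); have /continuousP/(_ O oO) := scE.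
Qed.

Lemma cgVS_kprod E F : cgVS E -> cgVS F -> cgVS (kprod E F).
Proof.
move=> hE hF; have hEF := kprod_cg (cgVS_hausdorff hE) (cgVS_hausdorff hF).
apply: cgVS_intro => //.
  have cX := kprod_cg (proj1 hEF) (proj1 hEF).
  apply/cts_onT.
  apply: (eq_cts_on (f := (fun z => (z.1.1 + z.2.1, z.1.2 + z.2.2))
                         : kprod (kprod E F) (kprod E F) -> kprod E F)) => //.
  apply: cts_on_kpair => //.
    apply: cts_onD => //.
    - by apply: (cts_on_compl (@kfst _ E F)); apply/cts_onT/kfst.
    - by apply: (cts_on_compl (@kfst _ E F)); apply/cts_onT/ksnd.
  apply: cts_onD => //.
  - by apply: (cts_on_compl (@ksnd _ E F)); apply/cts_onT/kfst.
  - by apply: (cts_on_compl (@ksnd _ E F)); apply/cts_onT/ksnd.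
have cX := kprod_cg (@Rhausdorff R) (proj1 hEF).
apply/cts_onT.
apply: (eq_cts_on (f := (fun z => (z.1 *: z.2.1, z.1 *: z.2.2))
                       : kprod R^o (kprod E F) -> kprod E F)) => //.
apply: cts_on_kpair => //.
  apply: cts_onZ => //; first by apply/cts_onT/(@kfst _ R^o).
  by apply: (cts_on_compl (@kfst _ E F)); apply/cts_onT/(@ksnd _ R^o).
apply: cts_onZ => //; first by apply/cts_onT/(@kfst _ R^o).
by apply: (cts_on_compl (@ksnd _ E F)); apply/cts_onT/(@ksnd _ R^o).
Qed.

Section LcgCg.
Variables (E F : preTopologicalLmodType R) (hE : cgVS E) (hF : cgVS F).
Local Notation L := (Lcg hE hF).
Local Notation C := (cts_co E F).

Definition mkLcg (f : E -> F) (lf : linear f) (cf : continuous f) : L :=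
  exist (fun f => is_true (clin f)) f (asboolT (conj lf cf)).

Lemma co_eval (u : E) : continuous (fun p : kelley C => (p : E -> F) u).
Proof.
apply/continuousP => O oO.
apply: open_kopen; exists [set g : {compact-open, E -> F} | g @` [set u] `<=` O].
  by apply: compact_open_open => //; exact: compact_set1.
rewrite predeqE => p; split=> [/= h|Opu _ [_ -> <-]//]; exact: h (imageP _ erefl).
Qed.

Lemma co_hausdorff : hausdorff_space (kelley C).
Proof.
move=> p q pq; apply/continuousEP => u; apply: (cgVS_hausdorff hF) => A B nA nB.
by have [r [Ar Br]] := pq _ _ (@co_eval u p _ nA) (@co_eval u q _ nB); exists ((r : E -> F) u).
Qed.

Lemma co_cg : compactly_generated (kelley C).
Proof. by split; [exact: co_hausdorff|exact: kelley_kopen]. Qed.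

Lemma Lcg_hausdorff : hausdorff_space L.
Proof.
apply: hausdorff_inj co_hausdorff; first exact: initial_continuous.
move=> g g' /continuousEP gg'; apply: val_inj; apply/funext => u; exact: gg'.
Qed.

(** Closedness holds for the k-topology: addition in [F] is continuous only on the
    k-product, so the equations defining linearity are continuous in the map only
    after Kelleyfication. *)
Lemma closed_linear : closed [set p : kelley C | linear (p : E -> F)].
Proof.
have -> : [set p : kelley C | linear (p : E -> F)] =
    \bigcap_(t in [set: R * E * E])
      [set p : kelley C | (p : E -> F) (t.1.1 *: t.1.2 + t.2) =
                          t.1.1 *: (p : E -> F) t.1.2 + (p : E -> F) t.2].
  rewrite predeqE => p; split=> [lp [[a u] v] _|lp a u v]; first exact: lp.
  exact: (lp (a, u, v)).
apply: closed_bigI => t _; apply: closed_equalizer; first exact: cgVS_hausdorff.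
  exact: co_eval.
apply/cts_onT; apply: cts_onD => //; [exact: co_cg| |exact/cts_onT/co_eval].
by apply: cts_onZ => //; [exact/cts_on_cst/openT|exact/cts_onT/co_eval].
Qed.

Lemma Lcg_closed_embedding : exists i : L -> kelley C,
  [/\ injective i, range i = [set p : kelley C | linear (p : E -> F)],
      forall V : set L, open V <-> exists2 W, open W & i @^-1` W = V &
      forall A, A `<=` range i -> compact A -> compact (i @^-1` A)].
Proof.
exists (@cts_of_Lcg _ _ _ hE hF); split=> [g g' /continuousEP gg'| |//|].
- by apply: val_inj; apply/funext => u; exact: gg'.
- rewrite predeqE => p; split=> [[g _ <-]|lp]; first exact: Lcg_linear.
  by exists (mkLcg lp (@cts_fun _ _ p)) => //; apply/continuousEP.
- exact: compact_initial.
Qed.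

(** A closed subspace of a k-space is a k-space: a k-open set of the subspace, enlarged
    by the complement of the subspace, is k-open in the whole space. *)
Lemma Lcg_cg : compactly_generated L.
Proof.
split; first exact: Lcg_hausdorff.
rewrite predeqE => O; split=> [kO|]; last exact: open_kopen.
have [i [inji ri oi ci]] := Lcg_closed_embedding.
have clr : closed (range i) by rewrite ri; exact: closed_linear.
suff oW : open [set p | forall g, i g = p -> O g].
  apply/oi; exists [set p | forall g, i g = p -> O g] => //.
  by rewrite predeqE => g; split=> [/(_ g erefl)//|Og g' /inji ->].
rewrite -(proj2 co_cg); apply: kopenP => K p cK Kp Wp.
have [[g0 _ ig0]|nrp] := pselect (range i p); last first.
  exists (~` range i); split=> //; first exact: closed_openC.
  by move=> q [nrq _] g iq; case: nrq; exists g.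
have cA : compact (i @^-1` (K `&` range i)).
  by apply: ci; [exact: subIsetr|exact: compact_closedI].
have [V' /oi[V oV VV'] OV] := kO _ cA.
exists V; split=> //.
  have : (O `&` i @^-1` (K `&` range i)) g0.
    by split; [exact: (Wp _ ig0)|rewrite /preimage/= ig0; split=> //; exists g0].
  by rewrite OV -VV' -ig0 => -[].
move=> q [Vq Kq] g iq.
have : (V' `&` i @^-1` (K `&` range i)) g.
  by rewrite -VV' /preimage/= iq; split=> //; split=> //; exists g.
by rewrite -OV => -[].
Qed.

(** By the exponential law the operations on linear maps are continuous because the
    pointwise operations are jointly continuous after evaluation. *)
Lemma cgVS_Lcg : cgVS L.
Proof.
apply: cgVS_intro; first exact: Lcg_cg.
  have cX := kprod_cg Lcg_hausdorff Lcg_hausdorff.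
  have cY := kprod_cg (proj1 cX) (cgVS_hausdorff hE).
  apply/cts_onT; apply: (@Lcg_curry _ _ _ hE hF (kprod L L) setT
    (fun z : kprod (kprod L L) E => val z.1.1 z.2 + val z.1.2 z.2)) => //.
  apply: (@cts_onD _ (kprod (kprod L L) E)) => //.
    apply: cts_on_ev => //; last exact/cts_onT/ksnd.
    by apply: (cts_on_compl (@kfst _ L L)); apply/cts_onT/kfst.
  apply: cts_on_ev => //; last exact/cts_onT/ksnd.
  by apply: (cts_on_compl (@ksnd _ L L)); apply/cts_onT/kfst.
have cX := kprod_cg (@Rhausdorff R) Lcg_hausdorff.
have cY := kprod_cg (proj1 cX) (cgVS_hausdorff hE).
apply/cts_onT; apply: (@Lcg_curry _ _ _ hE hF (kprod R^o L) setT
  (fun z : kprod (kprod R^o L) E => z.1.1 *: val z.1.2 z.2)) => //.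
apply: (@cts_onZ _ (kprod (kprod R^o L) E)) => //.
  by apply: (cts_on_compl (@kfst _ R^o L)); apply/cts_onT/kfst.
apply: cts_on_ev => //; last exact/cts_onT/ksnd.
by apply: (cts_on_compl (@ksnd _ R^o L)); apply/cts_onT/kfst.
Qed.

End LcgCg.
End CgVS.

(** * Locally convex topologies given by their neighbourhoods of 0 *)

Section LcsBase.
Variable R : realType.
Implicit Types V : lmodType R.

Definition is_convex V (W : set V) :=
  forall x y (t : R), 0 <= t -> t <= 1 -> W x -> W y -> W (t *: x + (1 - t) *: y).

Lemma is_convexP V (W : set V) : is_convex W <-> convex_set (W : set (convex_lmodType V)).
Proof.
split=> [cW x y t /set_mem Wx /set_mem Wy|cW x y t t0 t1 Wx Wy].
  by apply/mem_set; exact: cW.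
exact: set_mem (cW x y (Itv01 t0 t1) (mem_set Wx) (mem_set Wy)).
Qed.

(** The neighbourhood filter [N] of 0 for a sequentially complete Hausdorff locally
    convex topology.  Describing that topology by [N] alone leaves the type [V] free to
    carry its own, finer topology. *)
Record lcs_base V (N : set_system V) : Prop := LcsBase {
  lcs_filter : Filter N ;
  lcs_0 : forall W, N W -> W 0 ;
  lcs_add : forall W, N W -> exists2 W', N W' & forall x y, W' x -> W' y -> W (x + y) ;
  lcs_scale : forall (a : R^o) W, N W -> exists2 W', N W' &
    \forall b \near a, forall x, W' x -> W (b *: x) ;
  lcs_absorb : forall x W, N W -> \forall b \near (0 : R^o), W (b *: x) ;
  lcs_convex : forall W, N W -> exists W', [/\ N W', is_convex W' & W' `<=` W] ;
  lcs_hausdorff : forall x, (forall W, N W -> W x) -> x = 0 ;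
  lcs_complete : forall u : nat -> V,
    (forall W, N W -> exists M : nat, forall m n : nat,
      (M <= m)%N -> (M <= n)%N -> W (u m - u n)) ->
    exists l, forall W, N W -> exists M : nat, forall n : nat, (M <= n)%N -> W (u n - l) }.

Section LcsTopology.
Variables (V : lmodType R) (N : set_system V).
Hypothesis (hN : lcs_base N).

(** The translation-invariant topology with [N] as neighbourhoods of 0. *)
Definition lcs_opens : set_system V := [set O | forall x, O x -> N [set h | O (x + h)]].

Lemma lcs_opensT : lcs_opens setT.
Proof. by move=> x _; apply: (@filterT _ _ (lcs_filter hN)). Qed.

Lemma lcs_opensI : setI_closed lcs_opens.
Proof.
by move=> A B oA oB x [Ax Bx]; apply: (@filterI _ _ (lcs_filter hN)); [exact: oA|exact: oB].
Qed.

Lemma lcs_opens_bigU (I : Type) (f : I -> set V) :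
  (forall i, lcs_opens (f i)) -> lcs_opens (\bigcup_i f i).
Proof.
move=> of_ x [i _ fix_]; apply: (@filterS _ _ (lcs_filter hN)) (of_ i x fix_) => h fh.
by exists i.
Qed.

Definition lcs_topology := TopologyOn lcs_opensT lcs_opensI lcs_opens_bigU.
Local Notation T := (retopologize lcs_topology).

Lemma lcs_nbhs (x : T) (W : set T) : nbhs x W <-> N [set h : V | W (x + h)].
Proof.
have FN := lcs_filter hN; split=> [[O [oO Ox OW]]|NW].
  by apply: filterS (oO x Ox) => h; exact: OW.
exists [set y : V | N [set h | W (y + h)]]; split=> //.
- move=> y Ny; have [W' NW' W'W] := lcs_add hN Ny.
  apply: filterS (NW') => h W'h; apply: filterS (NW') => h' W'h' /=.
  by rewrite -addrA; exact: W'W.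
- by move=> y /= /(lcs_0 hN) /=; rewrite addr0.
Qed.

Lemma lcs_neg W : N W -> exists2 W', N W' & forall x, W' x -> W (- x).
Proof.
move=> /(lcs_scale hN (-1))[W' NW' /nbhs_singleton h]; exists W' => // x /h.
by rewrite scaleN1r.
Qed.

Lemma lcs_sub W : N W -> exists2 W', N W' & forall x y, W' x -> W' y -> W (x - y).
Proof.
have FN := lcs_filter hN.
move=> /(lcs_add hN)[W1 NW1 h1]; have [W2 NW2 h2] := lcs_neg NW1.
by exists (W1 `&` W2) => [|x y [? _] [_ ?]]; [exact: filterI|apply: h1 => //; exact: h2].
Qed.

Lemma lcs_topology_scl : seq_complete_hausdorff_lcs (T : preTopologicalLmodType R).
Proof.
have FN := lcs_filter hN; split.
- move=> [x y] W /lcs_nbhs /(lcs_add hN)[W' NW' W'W].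
  exists ([set z | W' (z - x)], [set z | W' (z - y)]) => /=.
    by split; apply/lcs_nbhs; apply: filterS (NW') => h /=; rewrite addrAC subrr add0r.
  move=> [x' y'] /= [Wx' Wy'].
  have -> : x' + y' = (x + y) + ((x' - x) + (y' - y)) by rewrite addrACA !subrKC.
  exact: (W'W _ _ Wx' Wy').
- move=> [a x] W /lcs_nbhs /= NW; have [W1 NW1 W1W] := lcs_add hN NW.
  have [W2 NW2 hW2] := lcs_scale hN a NW1.
  have /= ha := lcs_absorb hN x NW1.
  exists ([set b | (forall z, W2 z -> W1 (b *: z)) /\ W1 ((b - a) *: x)],
          [set z | W2 (z - x)]) => /=.
    split; last by apply/lcs_nbhs; apply: filterS (NW2) => h /=; rewrite addrAC subrr add0r.
    apply: filterI => //.
    have ca : (fun b : R^o => b - a) @ a --> (0 : R^o).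
      rewrite -(subrr a); apply: cvgB; [exact: cvg_id|exact: cvg_cst].
    exact: (ca _ ha).
  move=> [b z] /= [[hb1 hb2] hz].
  have -> : b *: z = a *: x + (b *: (z - x) + (b - a) *: x).
    by rewrite scalerBr scalerBl subrKA subrKC.
  exact: (W1W _ _ (hb1 _ hz) hb2).
- exists [set O : set T | open O /\ is_convex (O : set V)].
    by move=> O /set_mem[_ /is_convexP].
  split; first by move=> O [].
  move=> x W /lcs_nbhs/(lcs_convex hN)[W' [NW' cW' W'W]] /=.
  exists [set y : T | N [set h : V | W' (y - x + h)]]; last first.
    move=> y /= /(lcs_0 hN) /=; rewrite addr0 => /W'W /=.
    by rewrite addrC subrK.
  split.
    split.
      move=> y /= Ny; have [W1 NW1 h1] := lcs_add hN Ny.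
      apply: filterS (NW1) => h W1h; apply: filterS (NW1) => h' W1h' /=.
      have -> : y + h - x + h' = y - x + (h + h') by rewrite (addrAC y h) addrA.
      exact: (h1 _ _ W1h W1h').
    move=> y z t t0 t1 /= Ny Nz; apply: filterS (filterI Ny Nz) => h [/= Wy Wz].
    have := cW' _ _ t t0 t1 Wy Wz; congr W'.
    by rewrite !scalerDr addrACA [X in X + _]addrACA -2!scalerDl subrKC !scale1r.
  by rewrite /= subrr; apply: filterS NW' => h; rewrite /= add0r.
- move=> x y xy; apply/esym/eqP; rewrite -subr_eq0; apply/eqP; apply: (lcs_hausdorff hN).
  move=> W /lcs_sub[W1 NW1 h1].
  have [||z [/= zx zy]] := xy [set z | W1 (z - x)] [set z | W1 (z - y)].
  + by apply/lcs_nbhs; apply: filterS (NW1) => h /=; rewrite addrAC subrr add0r.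
  + by apply/lcs_nbhs; apply: filterS (NW1) => h /=; rewrite addrAC subrr add0r.
  by have := h1 _ _ zx zy; rewrite opprB addrC addrA subrK.
- move=> u cu; have [|l hl] := lcs_complete hN (u := u).
    by move=> W NW; apply: cu; apply/lcs_nbhs; apply: filterS NW => h /=; rewrite add0r.
  exists l => W /lcs_nbhs /hl[M hM]; exists M => // n /= /hM /=.
  by rewrite addrC subrK.
Qed.

End LcsTopology.
End LcsBase.

(** * The class scgVS through neighbourhoods of 0 *)

Section Kbase.
Variable R : realType.
Implicit Types E F : preTopologicalLmodType R.

(** The link between [N] and the topology of [F]: for [F] compactly generated, its
    topology is the Kelleyfication of the one given by [N] exactly when it is finer than
    the latter and when, for maps out of k-spaces, continuity on compact sets for [N]
    implies continuity into [F].  All estimates below are made in [N], where convexity and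
    continuity of addition are available, and transferred to [F] by [kbase_test]. *)
Record kbase F (N : set_system F) : Prop := Kbase {
  kbase_lcs : lcs_base N ;
  kbase_nbhs : forall (x : F) W, N W -> nbhs x [set y | W (y - x)] ;
  kbase_test : forall (X : topologicalType) (D : set X) (f : X -> F),
    compactly_generated X -> open D ->
    (forall K x, compact K -> K `<=` D -> K x -> forall W, N W ->
      \forall y \near x, K y -> W (f y - f x)) ->
    cts_on D f }.

Section FromTopology.
Variables (F : preTopologicalLmodType R) (U : topology_on F).
Local Notation T := (retopologize U).
Hypothesis (lcU : seq_complete_hausdorff_lcs (T : preTopologicalLmodType R)).

Lemma scl_translate (x : T) (W : set T) : nbhs x W <-> nbhs (0 : T) [set h | W (x + h)].
Proof.
have [cadd _ _ _] := lcU.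
have ctr (a : T) : continuous (fun h : T => a + h : T).
  apply/cts_onT.
  apply: (@cts_on_compl T (T * T)%type T setT (fun h => (a, h)) (fun z => z.1 + z.2 : T) cadd).
  by apply: cts_on_pair; [exact/cts_on_cst/openT|exact/cts_on_id/openT].
split=> [nW|nW].
  have nW0 : nbhs (x + (0 : T)) W by rewrite addr0.
  exact: (ctr x 0 W nW0).
have : nbhs x [set y : T | W (x + (- x + y))].
  have nW0 : nbhs (- x + x) [set h | W (x + h)] by rewrite addNr.
  exact: (ctr (- x) x _ nW0).
by apply: filterS => y /=; rewrite addrA subrr add0r.
Qed.

Lemma scl_base : lcs_base (nbhs (0 : T) : set_system F).
Proof.
have [cadd csc [B cB [Bo bB]] hT cT] := lcU; split.
- exact: (@nbhs_filter T 0).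
- by move=> W; exact: nbhs_singleton.
- move=> W nW; have nW0 : nbhs ((0 : T) + 0) W by rewrite addr0.
  have [[A1 A2] /= [n1 n2] A12] := cadd (0, 0) W nW0.
  exists (A1 `&` A2); first exact: filterI.
  by move=> x y [Ax _] [_ Ay]; exact: (A12 (x, y)).
- move=> a W nW; have nW0 : nbhs (a *: (0 : T)) W by rewrite scaler0.
  have [[A1 A2] /= [n1 n2] A12] := csc (a, 0) W nW0.
  exists A2 => //; apply: filterS n1 => b Ab x Ax.
  exact: (A12 (b, x)).
- move=> x W nW; have nW0 : nbhs (0 *: (x : T)) W by rewrite scale0r.
  have [[A1 A2] /= [n1 n2] A12] := csc (0, x) W nW0.
  apply: filterS n1 => b Ab; apply: (A12 (b, x)); split=> //; exact: nbhs_singleton n2.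
- move=> W nW; have [O [BO O0] OW] := bB _ _ nW; exists O; split=> //.
    by apply: open_nbhs_nbhs; split=> //; exact: Bo.
  by apply/is_convexP; apply: cB; exact: mem_set.
- move=> x hx; apply/esym/hT => A C nA nC; exists x; split; first exact: hx.
  exact: nbhs_singleton nC.
- move=> u /cT[l ul]; exists l => W nW.
  have nWl : nbhs (l : T) [set y | W (y - l)].
    by apply/scl_translate; apply: filterS nW => h /=; rewrite addrAC subrr add0r.
  by have [M _ hM] := ul _ nWl; exists M => n Mn; exact: hM.
Qed.

Lemma scl_kbase : @open F = @kopen T -> kbase (nbhs (0 : T) : set_system F).
Proof.
move=> oF; split; first exact: scl_base.
  move=> x W nW.
  have : nbhs (x : T) [set y | W (y - x)].
    by apply/scl_translate; apply: filterS nW => h /=; rewrite addrAC subrr add0r.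
  rewrite nbhsE => -[O [oO Ox] OW]; apply: filterS OW _.
  by apply: open_nbhs_nbhs; split=> //; rewrite oF; exact: open_kopen.
move=> X D f cX oD hf.
suff h : @cts_on X (kelley T) D f by move=> O; rewrite oF; exact: h.
apply: kelley_lift_compactly => // K cK KD; apply/subspace_continuousP => x Kx W.
move=> /scl_translate /(hf K x cK KD Kx); apply: filterS => y h /h /=.
by rewrite subrKC.
Qed.

End FromTopology.

(** From right to left, [kbase_test] is applied to the identity map from the
    Kelleyfication of the topology given by [N]. *)
Lemma scgVSP F : scgVS F <-> cgVS F /\ exists N : set_system F, kbase N.
Proof.
split=> [[hF [U [lcU oF]]]|[hF [N [lN nN tN]]]].
  by split=> //; exists (nbhs (0 : retopologize U)); exact: scl_kbase.
split=> //; exists (lcs_topology lN); split; first exact: lcs_topology_scl.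
pose T := retopologize (lcs_topology lN).
have hT : hausdorff_space T by have [_ _ []] := lcs_topology_scl lN.
have cT : continuous (fun x : F => x : T).
  by move=> x W /lcs_nbhs /(nN x); apply: filterS => y /=; rewrite subrKC.
have tT : @cts_on (kelley T) F setT (fun x => x).
  apply: tN; [exact: kelley_cg|exact: openT|move=> K x cK _ Kx W NW].
  have nW : nbhs (x : T) [set y : T | W (y - x)].
    apply/lcs_nbhs; apply: (@filterS _ _ (lcs_filter lN)) (NW) => h Wh /=.
    by rewrite addrAC subrr add0r.
  have nK : nbhs (x : kelley T) [set y : T | W (y - x)] := @kelley_id T x _ nW.
  by apply: filterS nK.
have cT' : @cts_on F T setT (fun x => x) by apply/cts_onT.
have kT := kelley_lift (cgVS_cg hF) cT'.
rewrite predeqE => O; split=> oO.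
  by have := tT O oO; rewrite setTI.
by have := kT O oO; rewrite setTI.
Qed.

(** The triangle inequality in a topological vector space. *)
Lemma lcs_half (V : lmodType R) (N : set_system V) W : lcs_base N -> N W ->
  exists2 W', N W' & forall x y z, W' (x - y) -> W' (y - z) -> W (x - z).
Proof.
move=> lN /(lcs_add lN)[W' NW' h]; exists W' => // x y z hx hy.
by rewrite -(subrKA y); exact: h.
Qed.

Lemma scgVS_cgVS F : scgVS F -> cgVS F. Proof. by case. Qed.

Lemma kbase_near F (N : set_system F) (X : topologicalType) (f : X -> F) (x : X) W :
  kbase N -> {for x, continuous f} -> N W -> \forall y \near x, W (f y - f x).
Proof. by move=> kN cf NW; exact: (cf _ (kbase_nbhs kN (f x) NW)). Qed.

Section Product.
Variables (E F : preTopologicalLmodType R).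
Variables (NE : set_system E) (NF : set_system F).

Definition prod_base : set_system (kprod E F) :=
  [set W | exists W1 W2, [/\ NE W1, NF W2 & forall x y, W1 x -> W2 y -> W (x, y)]].

Lemma prod_lcs_base : lcs_base NE -> lcs_base NF -> lcs_base prod_base.
Proof.
move=> lE lF; have FE := lcs_filter lE; have FF := lcs_filter lF; split.
- split.
  + by exists setT, setT; split=> //; exact: filterT.
  + move=> A B [A1 [A2 [nA1 nA2 hA]]] [B1 [B2 [nB1 nB2 hB]]].
    exists (A1 `&` B1), (A2 `&` B2); split; [exact: filterI|exact: filterI|].
    by move=> x y [? ?] [? ?]; split; [exact: hA|exact: hB].
  + move=> A B AB [A1 [A2 [nA1 nA2 hA]]]; exists A1, A2; split=> // x y ? ?.
    by apply/AB/hA.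
- by move=> W [W1 [W2 [n1 n2 h]]]; apply: h; [exact: lcs_0 n1|exact: lcs_0 n2].
- move=> W [W1 [W2 [/(lcs_add lE)[V1 n1 h1] /(lcs_add lF)[V2 n2 h2] h]]].
  exists (V1 `*` V2); first by exists V1, V2.
  by move=> [x y] [x' y'] [/= ? ?] [/= ? ?]; apply: h; [exact: h1|exact: h2].
- move=> a W [W1 [W2 [/(lcs_scale lE a)[V1 n1 h1] /(lcs_scale lF a)[V2 n2 h2] h]]].
  exists (V1 `*` V2); first by exists V1, V2.
  apply: filterS (filterI h1 h2) => b [b1 b2] [x y] [/= ? ?].
  by apply: h; [exact: b1|exact: b2].
- move=> [x y] W [W1 [W2 [/(lcs_absorb lE x) n1 /(lcs_absorb lF y) n2 h]]].
  by apply: filterS (filterI n1 n2) => b [? ?]; exact: h.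
- move=> W [W1 [W2 [/(lcs_convex lE)[V1 [n1 c1 h1]] /(lcs_convex lF)[V2 [n2 c2 h2]] h]]].
  exists (V1 `*` V2); split; first by exists V1, V2.
    move=> [x y] [x' y'] t t0 t1 [/= ? ?] [/= ? ?].
    by split; [exact: c1|exact: c2].
  by move=> [x y] [/= /h1 ? /h2 ?]; exact: h.
- move=> [x y] h; congr (_, _).
    apply: (lcs_hausdorff lE) => W nW.
    have : (W `*` [set: F]) (x, y).
      by apply: h; exists W, setT; split=> //; exact: filterT.
    by case.
  apply: (lcs_hausdorff lF) => W nW.
  have : ([set: E] `*` W) (x, y).
    by apply: h; exists setT, W; split=> //; exact: filterT.
  by case.
- move=> u cu.
  have [W nW|l1 h1] := lcs_complete lE (u := fun n => (u n).1).
    have [|M hM] := cu (W `*` setT).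
      by exists W, setT; split=> //; exact: filterT.
    by exists M => m n Mm Mn; have [] := hM m n Mm Mn.
  have [W nW|l2 h2] := lcs_complete lF (u := fun n => (u n).2).
    have [|M hM] := cu (setT `*` W).
      by exists setT, W; split=> //; exact: filterT.
    by exists M => m n Mm Mn; have [] := hM m n Mm Mn.
  exists (l1, l2) => W [W1 [W2 [/h1[M1 hM1] /h2[M2 hM2] h]]].
  exists (maxn M1 M2) => n; rewrite geq_max => /andP[/hM1 ? /hM2 ?].
  exact: (h _ _).
Qed.

Lemma prod_kbase : kbase NE -> kbase NF -> kbase prod_base.
Proof.
move=> kE kF; split; first by apply: prod_lcs_base; exact: kbase_lcs.
- move=> z W [W1 [W2 [n1 n2 h]]].
  have m1 := kbase_near kE (@kfst _ E F z) n1.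
  have m2 := kbase_near kF (@ksnd _ E F z) n2.
  by apply: filterS (filterI m1 m2) => -[y1 y2] [/= ? ?]; exact: (h _ _).
- move=> X D f cX oD hf.
  apply: (eq_cts_on (f := (fun x => ((f x).1, (f x).2)) : X -> kprod E F)).
    by move=> x _; case: (f x).
  have FE := lcs_filter (kbase_lcs kE); have FF := lcs_filter (kbase_lcs kF).
  apply: cts_on_kpair => //.
    apply: (kbase_test kE) => // K x cK KD Kx W nW.
    have : prod_base (W `*` setT) by exists W, setT; split=> //; exact: filterT.
    by move=> /(hf K x cK KD Kx); apply: filterS => y h /h [].
  apply: (kbase_test kF) => // K x cK KD Kx W nW.
  have : prod_base (setT `*` W) by exists setT, W; split=> //; exact: filterT.
  by move=> /(hf K x cK KD Kx); apply: filterS => y h /h [].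
Qed.

End Product.

Lemma scgVS_kprod E F : scgVS E -> scgVS F -> scgVS (kprod E F).
Proof.
move=> /scgVSP[hE [NE kE]] /scgVSP[hF [NF kF]]; apply/scgVSP; split.
  exact: cgVS_kprod.
by exists (prod_base NE NF); exact: prod_kbase.
Qed.

End Kbase.

(** * Spaces of continuous linear maps belong to scgVS *)

Section LcgLcs.
Variables (R : realType) (E F : preTopologicalLmodType R).
Variables (hE : cgVS E) (hF : cgVS F) (N : set_system F) (kN : kbase N).
Local Notation L := (Lcg hE hF).
Let lN : lcs_base N := kbase_lcs kN.
Let FN : Filter N := lcs_filter lN.

(** Uniform convergence on compact sets, for the locally convex topology on [F]. *)
Definition ucc_base : set_system L :=
  [set W | exists C W', [/\ compact C, N W' &
    forall v : L, (forall u : E, C u -> W' (val v u)) -> W v]].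

Lemma ucc_baseI (C : set E) (W : set F) : compact C -> N W ->
  ucc_base [set v | forall u, C u -> W (val v u)].
Proof. by move=> cC nW; exists C, W. Qed.

Lemma Lcg_valB (v w : L) u : val (v - w) u = val v u - val w u.
Proof. by []. Qed.

Definition ncvg (u : nat -> F) (l : F) :=
  forall W, N W -> exists M : nat, forall n : nat, (M <= n)%N -> W (u n - l).

Lemma ncvg_unique u l l' : ncvg u l -> ncvg u l' -> l = l'.
Proof.
move=> ul ul'; apply/eqP; rewrite -subr_eq0; apply/eqP; apply: (lcs_hausdorff lN) => W.
move=> /(lcs_sub lN)[W' NW' h]; have [M hM] := ul' _ NW'; have [M' hM'] := ul _ NW'.
have -> : l - l' = (u (maxn M M') - l') - (u (maxn M M') - l).
  by rewrite opprB [RHS]addrC subrKA.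
by apply: h; [apply: hM; exact: leq_maxl|apply: hM'; exact: leq_maxr].
Qed.

Lemma ncvg_linear u v l m a : ncvg u l -> ncvg v m ->
  ncvg (fun n => a *: u n + v n) (a *: l + m).
Proof.
move=> ul vm W /(lcs_add lN)[W' NW' h].
have [W2 NW2 /nbhs_singleton h2] := lcs_scale lN a NW'.
have [M hM] := ul _ NW2; have [M' hM'] := vm _ NW'.
exists (maxn M M') => n; rewrite geq_max => /andP[/hM un /hM' vn].
by rewrite opprD addrACA -scalerBr; apply: h => //; exact: h2.
Qed.

(** The delicate axiom is completeness.  A Cauchy sequence converges pointwise to a
    linear map, uniformly on compact sets; hence the limit is continuous on compact sets
    for the locally convex topology, which is enough since [E] is a k-space. *)
Lemma ucc_lcs_base : lcs_base ucc_base.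
Proof.
split.
- split.
  + by exists set0, setT; split=> //; [exact: compact0|exact: filterT].
  + move=> A B [C [W [cC nW h]]] [C' [W' [cC' nW' h']]].
    exists (C `|` C'), (W `&` W'); split; [exact: compactU|exact: filterI|].
    move=> v hv; split; [apply: h|apply: h'] => u Cu.
      by have [] := hv u (or_introl Cu).
    by have [] := hv u (or_intror Cu).
  + by move=> A B AB [C [W [cC nW h]]]; exists C, W; split=> // v /h /AB.
- move=> W [C [W' [cC nW h]]]; apply: h => u _; exact: (lcs_0 lN nW).
- move=> W [C [W' [cC /(lcs_add lN)[V nV hV] h]]].
  exists [set v | forall u, C u -> V (val v u)]; first exact: ucc_baseI.
  by move=> v w hv hw; apply: h => u Cu; apply: hV; [exact: hv|exact: hw].
- move=> a W [C [W' [cC /(lcs_scale lN a)[V nV hV] h]]].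
  exists [set v | forall u, C u -> V (val v u)]; first exact: ucc_baseI.
  by apply: filterS hV => b hb v hv; apply: h => u Cu; apply: hb; exact: hv.
- move=> v W [C [W' [cC /(lcs_add lN)[V nV hV] h]]].
  have /compact_near_coveringP cov := cC.
  have := cov R^o (nbhs (0 : R^o)) (fun b u => W' (b *: val v u)) _ _.
  suff hc : forall u, C u -> \forall u' \near u & b \near (0 : R^o), W' (b *: val v u').
    by move=> /(_ _ hc); apply: filterS => b hb; apply: h => u Cu; exact: hb.
  move=> u Cu; have [V2 nV2 hV2] := lcs_scale lN 0 nV.
  have cv := kbase_near kN (@Lcg_continuous _ _ _ hE hF v u) nV2.
  have ab := lcs_absorb lN (val v u) nV.
  exists ([set u' | V2 (val v u' - val v u)],
     [set b : R^o | V (b *: val v u) /\ forall x, V2 x -> V (b *: x)]) => /=.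
    by split=> //; exact: filterI.
  move=> [u' b] /= [hu' [hb1 hb2]].
  by rewrite -(subrKC (val v u) (val v u')) scalerDr; apply: hV => //; exact: hb2.
- move=> W [C [W' [cC /(lcs_convex lN)[V [nV cV hV]] h]]].
  exists [set v | forall u, C u -> V (val v u)]; split; first exact: ucc_baseI.
    by move=> v w t t0 t1 hv hw u Cu; apply: cV => //; [exact: hv|exact: hw].
  by move=> v hv; apply: h => u Cu; apply: hV; exact: hv.
- move=> v hv; apply: val_inj; apply/funext => u; apply: (lcs_hausdorff lN) => W nW.
  by have /hv : ucc_base _ := ucc_baseI (@compact_set1 _ u) nW; apply.
- move=> u cu.
  have cpt x : exists l, ncvg (fun n => val (u n) x) l.
    apply: (lcs_complete lN) => W nW.
    have [M hM] := cu _ (ucc_baseI (@compact_set1 _ x) nW).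
    by exists M => m n Mm Mn; exact: (hM m n Mm Mn x erefl).
  have [l hl] := choice cpt.
  have unif C W : compact C -> N W ->
      exists M : nat, forall n : nat, (M <= n)%N -> forall x, C x -> W (val (u n) x - l x).
    move=> cC /(lcs_half lN)[W' nW' hW'].
    have [M hM] := cu _ (ucc_baseI cC nW'); exists M => n Mn x Cx.
    have [M' hM'] := hl x _ nW'.
    apply: (hW' _ (val (u (maxn M M')) x)); last by apply: hM'; exact: leq_maxr.
    exact: (hM n (maxn M M') Mn (leq_maxl _ _) x Cx).
  have ll : linear l.
    move=> a x y; apply: (ncvg_unique (hl _)).
    have := ncvg_linear a (hl x) (hl y).
    by congr ncvg; apply/funext => n; rewrite Lcg_linear.
  have cl : continuous l.
    apply/cts_onT; apply: (kbase_test kN); [exact: cgVS_cg|exact: openT|].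
    move=> K x cK _ Kx W /(lcs_half lN)[W1 nW1 hW1].
    have [W2 nW2 hW2] := lcs_half lN nW1.
    have [W3 nW3 hW3] := lcs_neg lN nW1.
    have [M hM] := unif K _ cK (@filterI _ _ FN _ _ nW3 nW2).
    have [_ hMx] := hM M (leqnn M) x Kx.
    apply: filterS (kbase_near kN (@Lcg_continuous _ _ _ hE hF (u M) x) nW2) => y hy Ky.
    have [hMy _] := hM M (leqnn M) y Ky.
    apply: (hW1 _ (val (u M) y) _ _ (hW2 _ (val (u M) x) _ hy hMx)).
    by rewrite -opprB; exact: hW3.

  exists (mkLcg hE hF ll cl) => W [C [W' [cC nW' h]]].
  have [M hM] := unif C W' cC nW'; exists M => n Mn; apply: h => x Cx.
  exact: (hM n Mn x Cx).
Qed.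

(** If [f] is continuous into uniform convergence on compact sets, then [f z.1 z.2] is
    continuous on compact sets of pairs for [N], hence continuous into [F], and the
    exponential law returns continuity of [f] for the compact-open topology of [F]. *)
Lemma ucc_kbase : kbase ucc_base.
Proof.
split; first exact: ucc_lcs_base.
- move=> v W [C [W' [cC nW' h]]].
  have cL : compactly_generated L := Lcg_cg hE hF.
  have cc : @cts_on (kprod L E) F setT (fun z => val z.1 z.2 - val v z.2).
    apply: cts_onB => //.
    - exact: (kprod_cg (proj1 cL) (cgVS_hausdorff hE)).
    - exact/cts_onT/Lcg_ev.
    - apply: (cts_on_compl (@Lcg_continuous _ _ _ hE hF v)); exact/cts_onT/ksnd.
  have : nbhs (0 : F) W'.
    have := kbase_nbhs kN 0 nW'; apply: filterS => y /=; by rewrite subr0.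
  rewrite nbhsE => -[O [oO O0] OW].
  have kO := cc O oO; rewrite setTI in kO.
  have oT := cg_tube cL cC kO.
  apply: filterS (open_nbhs_nbhs (conj oT _)) => /=.
    by move=> w hw; apply: h => u Cu; apply: OW; exact: hw.
  by move=> u Cu; rewrite /preimage/= subrr.
- move=> X D f cX oD hf.
  apply: (@Lcg_curry _ _ _ hE hF X D (fun z => val (f z.1) z.2)) => //.
  apply: (kbase_test kN).
  + apply: kelley_cg; apply: hausdorff_prod; [by case: cX|exact: cgVS_hausdorff].
  + have cf : continuous (fst : kelley (X * E) -> X).
      apply/cts_onT; apply: (@cts_on_compl _ (X * E)%type _ _ _ fst).
        by move=> z; exact: cvg_fst.
      by apply/cts_onT; exact: kelley_id.
    by move/continuousP: cf; exact.
  move=> K [x u] /kelley_compact cK KD Kxu W /(lcs_half lN)[W' nW' hW'].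
  have cK1 : compact (fst @` K).
    apply: continuous_compact cK; apply: continuous_subspaceT => z; exact: cvg_fst.
  have cK2 : compact (snd @` K).
    apply: continuous_compact cK; apply: continuous_subspaceT => z; exact: cvg_snd.
  have K1D : fst @` K `<=` D by move=> _ [z /KD Dz <-].
  have K1x : (fst @` K) x by exists (x, u).
  have h1 := hf _ x cK1 K1D K1x _ (ucc_baseI cK2 nW').
  have h2 := kbase_near kN (@Lcg_continuous _ _ _ hE hF (f x) u) nW'.
  have : nbhs ((x, u) : X * E) [set z | K z -> W (val (f z.1) z.2 - val (f x) u)].
    exists ([set y | (fst @` K) y -> forall u, (snd @` K) u -> W' (val (f y - f x) u)],
            [set v | W' (val (f x) v - val (f x) u)]) => //=.
    move=> [y v] /= [hy hv] Kyv; apply: (hW' _ (val (f x) v)) => //.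
    by rewrite -Lcg_valB; apply: hy; exists (y, v).
  exact: (@kelley_id _ (x, u)).
Qed.

End LcgLcs.

Lemma scgVS_Lcg (R : realType) (E F : preTopologicalLmodType R)
  (hE : cgVS E) (hF : cgVS F) : scgVS F -> scgVS (Lcg hE hF).
Proof.
move=> /scgVSP[_ [N kN]]; apply/scgVSP; split; first exact: cgVS_Lcg.
by exists (ucc_base N); exact: ucc_kbase.
Qed.

(** * Mean value theorem *)

Section MeanValue.
Variables (R : realType) (V : lmodType R) (B : set V) (phi : R -> V).
Hypothesis cB : is_convex B.
Hypothesis dB : forall s : R, 0 <= s -> s <= 1 -> exists2 d : R, 0 < d &
  forall r, r != 0 -> `|r| < d -> B (r^-1 *: (phi (s + r) - phi s)).

Let slope (a b : R) := B ((b - a)^-1 *: (phi b - phi a)).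

Let slope_trans a b c : a < b -> b < c -> slope a b -> slope b c -> slope a c.
Proof.
move=> ab bc hab hbc; have ac := lt_trans ab bc.
have ba0 : b - a != 0 by rewrite subr_eq0 gt_eqF.
have cb0 : c - b != 0 by rewrite subr_eq0 gt_eqF.
have ca0 : c - a != 0 by rewrite subr_eq0 gt_eqF.
have cap : 0 < c - a by rewrite subr_gt0.
have t0 : 0 <= (b - a) / (c - a) by rewrite divr_ge0// subr_ge0 ltW.
have t1 : (b - a) / (c - a) <= 1 by rewrite ler_pdivrMr// mul1r lerB// ltW.
have := cB t0 t1 hab hbc; rewrite /slope; congr B.
have -> : 1 - (b - a) / (c - a) = (c - b) / (c - a).
  rewrite -[X in X - _](divff ca0) -mulrBl; congr (_ / _).
  by rewrite opprB addrA subrK.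
rewrite !scalerA (mulrAC (b - a)) divff// (mulrAC (c - b)) divff// !mul1r -scalerDr.
by rewrite [X in _ *: X]addrC subrKA.
Qed.

(** Slopes in [B] over adjacent intervals combine into a slope in [B], being averaged by
    convexity; the supremum of the points that can be reached from 0 in this way is then
    reached itself and cannot be smaller than 1. *)
Lemma mean_value : B (phi 1 - phi 0).
Proof.
pose S := [set x : R | 0 <= x <= 1 /\ (x = 0 \/ slope 0 x)].
have S0 : S 0 by split; [rewrite lexx ler01|left].
have hS : has_sup S by split; [exists 0|exists 1 => x [/andP[]]].
pose s := sup S.
have s0 : 0 <= s by exact: (sup_upper_bound hS).
have s1 : s <= 1 by apply: ge_sup; [exists 0|move=> x [/andP[]]].
have [d d0 hd] := dB s0 s1.
have left_ x : x < s -> s - d < x -> slope x s.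
  move=> xs dx; have := hd (x - s); rewrite subr_eq0 lt_eqF// => /(_ isT).
  rewrite ltr0_norm ?subr_lt0// opprB ltrBlDl -ltrBlDr => /(_ dx).
  rewrite subrKC /slope; congr B.
  by rewrite -[x - s]opprB invrN scaleNr -scalerN opprB.
have Ss : s = 0 \/ slope 0 s.
  have [x Sx dx] := sup_adherent d0 hS.
  have xs : x <= s by exact: (sup_upper_bound hS).
  have [xs'|sx] := ltP x s; last first.
    have <- : x = s by apply/eqP; rewrite eq_le xs.
    by case: Sx.
  right; have hxs := left_ x xs' dx.
  case: Sx => /andP[x0 x1] [x0'|h0x]; first by rewrite -x0'.
  move: x0; rewrite le_eqVlt => /predU1P[x0'|x0]; first by rewrite x0'.
  exact: slope_trans x0 xs' h0x hxs.
have [s1'|s1'] := ltP s 1; last first.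
  have s1E : s = 1 by apply/eqP; rewrite eq_le s1.
  case: Ss => [s0'|]; first by move: (oner_neq0 R); rewrite -s1E s0' eqxx.
  by rewrite s1E /slope subr0 invr1 scale1r.
pose y := Num.min (s + d / 2) 1.
have sy : s < y by rewrite lt_min s1' andbT ltrDl divr_gt0.
have hsy : slope s y.
  have := hd (y - s); rewrite subr_eq0 gt_eqF// => /(_ isT).
  rewrite gtr0_norm ?subr_gt0// ltrBlDl subrKC; apply.
  by rewrite gt_min ltrD2l ltr_pdivrMr// ltr_pMr// ltr1n.
have Sy : S y.
  split; first by rewrite (ltW (le_lt_trans s0 sy)) ge_min lexx orbT.
  right; case: Ss => [s0'|h0s]; first by rewrite -s0'.
  move: s0; rewrite le_eqVlt => /predU1P[s0'|s0]; first by rewrite s0'.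
  exact: slope_trans s0 sy h0s hsy.
have := sup_upper_bound hS Sy; rewrite leNgt => /negP; case; exact: sy.
Qed.

End MeanValue.

(** * Difference quotients *)

Section Calculus.
Variable R : realType.
Implicit Types E F : preTopologicalLmodType R.

Definition dirder E F (f : E -> F) (x u : E) (l : F) :=
  (fun t : R^o => t^-1 *: (f (x + t *: u) - f x)) @ (0 : R^o)^' --> l.

Lemma dirder_unique E F (f : E -> F) x u l l' :
  hausdorff_space F -> dirder f x u l -> dirder f x u l' -> l = l'.
Proof. by move=> hF fl fl'; exact: (cvg_unique hF fl fl'). Qed.

Lemma dirder_curve E F (f : E -> F) x u (D : set R^o) (c : R^o -> F) :
  cts_on D c -> D 0 ->
  (forall t, D t -> t != 0 -> c t = t^-1 *: (f (x + t *: u) - f x)) ->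
  dirder f x u (c 0).
Proof.
move=> cc D0 cE W nW.
have nD : nbhs (0 : R^o) D.
  by apply: open_nbhs_nbhs; split=> //; exact: cts_on_open cc.
have nDW : nbhs (0 : R^o) (D `&` c @^-1` W).
  by apply: filterI => //; exact: (cts_on_near cc D0 nW).
by apply: filterS nDW => t [Dt Wt] t0; rewrite /= -cE.
Qed.

Definition cyl E F (D : set E) : set (kprod E F) := [set z | D z.1].

(** Identities between derivatives are obtained below from identities between
    difference quotients, both sides being continuous curves in the parameter [t].  Sums
    of limits are not directly available, as addition is only continuous on the
    k-product. *)
Lemma curve_eq0 F (D : set R^o) (a b : R^o -> F) :
  hausdorff_space F -> cts_on D a -> cts_on D b -> D 0 ->
  (forall t, D t -> t != 0 -> a t = b t) -> a 0 = b 0.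
Proof.
move=> hF ca cb D0 ab.
apply: (eq_at_closure hF (cts_on_near ca D0) (cts_on_near cb D0)
  (S := [set t | D t /\ t != 0])) => [A nA|t [Dt t0]]; last exact: ab.
have nDA : nbhs (0 : R^o) (D `&` A).
  by apply: filterI => //; apply: open_nbhs_nbhs; split=> //; exact: cts_on_open ca.
have /filter_ex[t [[Dt At] t0]] : (0 : R^o)^' ((D `&` A) `&` [set t | t != 0]).
  by apply: filterS nDA => t [? ?] ?.
by exists t.
Qed.

Variables (E F : preTopologicalLmodType R) (hE : cgVS E) (hF : cgVS F).
Local Notation X3 := (kprod (kprod E E) R^o).

Lemma X3_cg : compactly_generated X3.
Proof.
have hh := cgVS_hausdorff hE.
by apply: kprod_cg; [case: (kprod_cg hh hh)|exact: Rhausdorff].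
Qed.

Let c11 : continuous (fun z : X3 => z.1.1 : E).
Proof. by apply/cts_onT; apply: (cts_on_compl (@kfst _ E E)); apply/cts_onT/kfst. Qed.
Let c12 : continuous (fun z : X3 => z.1.2 : E).
Proof. by apply/cts_onT; apply: (cts_on_compl (@ksnd _ E E)); apply/cts_onT/kfst. Qed.
Let c2 : continuous (fun z : X3 => z.2 : R^o).
Proof. exact: ksnd. Qed.

Lemma line_continuous : continuous (fun z : X3 => z.1.1 + z.2 *: z.1.2 : E).
Proof.
apply/cts_onT; apply: cts_onD => //; [exact: X3_cg|exact/cts_onT/c11|].
by apply: cts_onZ => //; apply/cts_onT; [exact: c2|exact: c12].
Qed.

Definition secant_dom (D : set E) : set X3 :=
  [set z | D z.1.1 /\ D (z.1.1 + z.2 *: z.1.2)].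

Lemma secant_dom_open D : open D -> open (secant_dom D).
Proof.
move=> oD; apply: openI.
  by have /continuousP/(_ D oD) := c11.
by have /continuousP/(_ D oD) := line_continuous.
Qed.

Definition diffq (f : E -> F) (df : kprod E E -> F) (z : X3) : F :=
  if z.2 == 0 then df z.1 else z.2^-1 *: (f (z.1.1 + z.2 *: z.1.2) - f z.1.1).

Lemma diffq_off0 (D : set E) (f : E -> F) : cts_on D f ->
  cts_on (secant_dom D `&` [set z | z.2 != 0])
    (fun z : X3 => z.2^-1 *: (f (z.1.1 + z.2 *: z.1.2) - f z.1.1) : F).
Proof.
move=> cf; have oD := cts_on_open cf; have oU := secant_dom_open oD.
have oN : open [set z : X3 | z.2 != 0].
  have -> : [set z : X3 | z.2 != 0] = (fun z : X3 => z.2 : R^o) @^-1` (~` [set 0]).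
    by rewrite predeqE => z; split=> [/eqP|/eqP].
  have /continuousP := c2; apply; apply: closed_openC.
  exact: accessible_closed_set1 (hausdorff_accessible (@Rhausdorff R)) _.
have oUN := openI oU oN.
have cid (Y : topologicalType) (g : X3 -> Y) :
    continuous g -> cts_on (secant_dom D `&` [set z | z.2 != 0]) g.
  by move=> cg; apply: cts_on_sub (_ : cts_on setT g) oUN _ => //; apply/cts_onT.
apply: cts_onZ => //.
  apply: cts_onI => // z [_ /= z0].
  exact: (@cvgV R X3 (nbhs z) _ (fun z : X3 => z.2) z.2 z0 (@c2 z)).
apply: cts_onB => //; first exact: X3_cg.
  apply: (cts_on_comp (cid _ _ line_continuous) cf) => z [[]] //.
by apply: (cts_on_comp (cid _ _ c11) cf) => z [[]].
Qed.

(** This is where local convexity enters.  Near a point [(x, u, 0)], the tube lemma over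
    [0, 1] puts all values of [df] along the secant in a convex neighbourhood of
    [df (x, u)], and the mean value theorem puts the difference quotient there too.
    This gives continuity for the locally convex topology on [F], thus for its
    Kelleyfication because the source is a k-space. *)
Lemma diffq_cts_on (D : set E) (f : E -> F) (df : kprod E E -> F) :
  scgVS F -> cts_on D f -> cts_on (cyl D) df ->
  (forall x u, D x -> dirder f x u (df (x, u))) -> cts_on (secant_dom D) (diffq f df).
Proof.
move=> /scgVSP[_ [N kN]] cf cdf fdf; have oD := cts_on_open cf.
have lN := kbase_lcs kN.
apply: (kbase_test kN); [exact: X3_cg|exact: secant_dom_open|].
move=> K z _ KD /KD {KD}; have [z20|z20] := eqVneq z.2 0; last first.
  move=> Uz W nW.
  have c0 := diffq_off0 cf.
  have Uz0 : (secant_dom D `&` [set z | z.2 != 0]) z by [].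
  have nU : nbhs z (secant_dom D `&` [set z | z.2 != 0]).
    by apply: open_nbhs_nbhs; split=> //; exact: cts_on_open c0.
  have nWz := kbase_near kN (cts_on_near c0 Uz0) nW.
  apply: filterS2 nU nWz => y [_ /= y0] Wy _; rewrite /diffq (negbTE z20) (negbTE y0).
  exact: Wy.
case: z z20 => -[x u] t /= -> [/= Dx _] W nW.
have [W' [nW' cW' W'W]] := lcs_convex lN nW.
have [W2 nW2 hW2] := lcs_half lN nW'.
set c := df (x, u).
have := kbase_nbhs kN c nW2; rewrite nbhsE => -[O [oO Oc] OW].
(* the points x + (s t) u of the secant, with s in the last variable; for s = 0 the
   base point itself is recovered, whatever t is *)
pose line (p : kprod X3 R^o) : E := p.1.1.1 + p.2 *: (p.1.2 *: p.1.1.2).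
have cX4 : compactly_generated (kprod X3 R^o).
  by apply: kprod_cg; [case: X3_cg|exact: Rhausdorff].
have cfst3 (Y : topologicalType) (g : X3 -> Y) : continuous g ->
    cts_on setT (fun p : kprod X3 R^o => g p.1).
  by move=> cg; apply: (cts_on_compl cg); apply/cts_onT/kfst.
have cline : cts_on setT line.
  apply: cts_onD => //; first exact: (cfst3 _ _ c11).
  apply: cts_onZ => //; first by apply/cts_onT/(@ksnd _ X3 R^o).
  apply: cts_onZ => //; first exact: (cfst3 _ _ c2).
  exact: (cfst3 _ _ c12).
have cpair : @cts_on (kprod X3 R^o) (kprod E E) setT (fun p => (line p, p.1.1.2)).
  by apply: cts_on_kpair => //; exact: (cfst3 _ _ c12).
have kO := cpair _ (cdf _ oO); rewrite setTI in kO.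
have cI : compact (`[0, 1]%classic : set R^o) by exact: segment_compact.
have oT := cg_tube X3_cg cI kO.
apply: filterS (open_nbhs_nbhs (conj oT _)); last first.
  move=> s _; rewrite /preimage/= /line/= scale0r scaler0 addr0.
  by split.
move=> [[x' u'] t'] h _; apply: W'W; rewrite /diffq /= eqxx -/c.
have hs s : 0 <= s -> s <= 1 ->
    D (x' + s *: (t' *: u')) /\ W2 (df (x' + s *: (t' *: u'), u') - c).
  move=> s0 s1; have [|Ds Os] := h s; first by rewrite /= in_itv/= s0 s1.
  by split=> //; exact: OW.
case: eqVneq => [t'0|t'0].
  have [_] := hs 0 (lexx _) ler01; rewrite scale0r addr0 => h0.
  by apply: (hW2 _ c); rewrite ?subrr//; exact: (lcs_0 lN).
have cB : is_convex [set v | W' (v - c)].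
  move=> v w a a0 a1 /= Wv Ww; have := cW' _ _ _ a0 a1 Wv Ww; congr W'.
  by rewrite !scalerBr addrACA -opprD -scalerDl subrKC scale1r.
(* dividing by t' beforehand makes the derivative at s equal to
   df (x' + s t' u', u'), which the tube lemma controls *)
have := @mean_value R F _ (fun s => t'^-1 *: f (x' + s *: (t' *: u'))) cB.
rewrite scale1r scale0r addr0 -scalerBr; apply => s s0 s1.
have [Ds Ws] := hs s s0 s1.
have nd : nbhs (df (x' + s *: (t' *: u'), u')) [set y | W2 (y - df (x' + s *: (t' *: u'), u'))].
  exact: (kbase_nbhs kN).
have := fdf _ u' Ds _ nd; rewrite /dirder /= => /nbhs_ballP[d /= d0 hd].
have nt0 : 0 < `|t'| by rewrite normr_gt0.
exists (d / `|t'|); first by rewrite divr_gt0.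
move=> r r0 rd; apply: (hW2 _ (df (x' + s *: (t' *: u'), u'))) => //.
have /= := hd (r * t'); rewrite -ball_normE /= sub0r normrN normrM -ltr_pdivlMr//.
move=> /(_ rd); rewrite mulf_neq0// => /(_ isT).
have -> : x' + (s + r) *: (t' *: u') = x' + s *: (t' *: u') + (r * t') *: u'.
  by rewrite scalerDl addrA (scalerA r t').
by rewrite -scalerBr (scalerA r^-1) invfM.
Qed.

(** The difference quotient in the direction [a *: u + v] is the sum of the one at [x] in
    the direction [v] and of [a] times the one at the moved point [x + t *: v] in the
    direction [u]; let [t] tend to 0. *)
Lemma dirder_linear (D : set E) (f : E -> F) (df : kprod E E -> F) x :
  cts_on (secant_dom D) (diffq f df) -> D x -> linear (fun u => df (x, u)).
Proof.
move=> cq Dx a u v.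
have oU := cts_on_open cq.
pose p1 (t : R^o) : X3 := ((x, a *: u + v), t).
(* a quotient in the direction u with parameter a t is one in the direction a u *)
pose p2 (t : R^o) : X3 := ((x + t *: v, u), a * t).
pose p3 (t : R^o) : X3 := ((x, v), t).
have cR := R_cg R.
have cst (y : E) : cts_on [set: R^o] (fun=> y) by apply/cts_on_cst/openT.
have cid : cts_on [set: R^o] (fun t : R^o => t) by apply/cts_on_id/openT.
have c1 : cts_on setT p1 by apply: cts_on_kpair => //; exact: cts_on_kpair.
have c3 : cts_on setT p3 by apply: cts_on_kpair => //; exact: cts_on_kpair.
have cp2 : cts_on setT p2.
  apply: cts_on_kpair => //.
    apply: cts_on_kpair => //; apply: cts_onD => //; exact: cts_onZ.
  by apply/cts_onT; exact: mulrl_continuous.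
pose Om : set R^o := p1 @^-1` secant_dom D `&` (p2 @^-1` secant_dom D `&` p3 @^-1` secant_dom D).
have oOm : open Om.
  have := c1 _ oU; have := cp2 _ oU; have := c3 _ oU; rewrite !setTI => ? ? ?.
  by do 2!apply: openI => //.
have Om0 : Om 0.
  rewrite /Om /preimage /secant_dom /= !scale0r !addr0 mulr0 scale0r addr0.
  by split.
have sub (p : R^o -> X3) : cts_on setT p -> Om `<=` p @^-1` secant_dom D ->
    cts_on Om (fun t => diffq f df (p t)).
  by move=> cp Omp; apply: (cts_on_comp _ cq) => //; exact: cts_on_sub cp oOm _.
have cl : cts_on Om (fun t => diffq f df (p1 t)) by apply: sub => // t [].
have cr : cts_on Om (fun t => a *: diffq f df (p2 t) + diffq f df (p3 t)).
  apply: cts_onD => //; last by apply: sub => // t [_ []].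
  apply: cts_onZ => //; last by apply: sub => // t [_ []].
  exact: cts_on_cst.
have := curve_eq0 (cgVS_hausdorff hF) cl cr Om0.
rewrite /diffq /= mulr0 eqxx scale0r addr0; apply.
move=> t _ t0; rewrite (negbTE t0) mulf_eq0 (negbTE t0) orbF.
case: eqVneq => [->|a0].
  by rewrite !scale0r !add0r.
rewrite scalerA invfM mulrA divff// mul1r -scalerDr subrKA; congr (_ *: (f _ - _)).
by rewrite scalerDr scalerA (mulrC t) -addrA; congr (_ + _); rewrite addrC.
Qed.

End Calculus.

(** * Iterated differentiability of total functions *)

Section Cn.
Variable R : realType.
Implicit Types E F G : preTopologicalLmodType R.

(** The iterated variation of total functions considered on an open set: partial
    functions and the choice of limits disappear. *)
Fixpoint Cn (n : nat) E F (D : set E) (f : E -> F) : Prop :=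
  match n with
  | 0%N => cts_on D f
  | S m => cts_on D f /\ exists df : kprod E E -> F,
      (forall x u, D x -> dirder f x u (df (x, u))) /\ Cn m (cyl D) df
  end.

Lemma CnS n E F (D : set E) (f : E -> F) : Cn n.+1 D f <->
  cts_on D f /\ exists df : kprod E E -> F,
    (forall x u, D x -> dirder f x u (df (x, u))) /\ Cn n (cyl D) df.
Proof. by []. Qed.

Lemma Cn_cts n E F (D : set E) (f : E -> F) : Cn n D f -> cts_on D f.
Proof. by case: n => [|n] // []. Qed.

Lemma cyl_open E F (D : set E) : open D -> open (cyl D : set (kprod E F)).
Proof. by move=> oD; have /continuousP/(_ D oD) := @kfst _ E F. Qed.

Lemma cts_line E (x u : E) (D : set R^o) :
  cgVS E -> open D -> cts_on D (fun t : R^o => x + t *: u : E).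
Proof.
move=> hE oD; apply: cts_onD => //; [exact: R_cg|exact: cts_on_cst|].
by apply: cts_onZ => //; [exact: cts_on_id|exact: cts_on_cst].
Qed.

#[global] Arguments cts_line [E] x u [D].

Lemma open_line E (x u : E) (D : set E) :
  cgVS E -> open D -> open [set t : R^o | D (x + t *: u)].
Proof.
move=> hE oD; by have := cts_line x u hE (@openT R^o) _ oD; rewrite setTI.
Qed.

#[global] Arguments open_line [E] x u [D].

Lemma near_line E (x u : E) (D : set E) : cgVS E -> open D -> D x ->
  \forall t \near (0 : R^o), D (x + t *: u).
Proof.
move=> hE oD Dx; apply: open_nbhs_nbhs; split; first exact: open_line.
by rewrite /= scale0r addr0.
Qed.

#[global] Arguments near_line [E x] u [D].

Lemma eq_dirder E F (D : set E) (f g : E -> F) x u l :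
  cgVS E -> open D -> (forall y, D y -> f y = g y) -> D x ->
  dirder f x u l -> dirder g x u l.
Proof.
move=> hE oD fg Dx fl W /fl; apply: filterS2 (near_line u hE oD Dx) => t Dt.
by move=> h t0; rewrite /= -!fg//; exact: h.
Qed.

Lemma eq_Cn n E F (D : set E) (f g : E -> F) : cgVS E ->
  (forall x, D x -> f x = g x) -> Cn n D f -> Cn n D g.
Proof.
move=> hE fg; case: n => [|n] /=; first exact: eq_cts_on.
move=> [cf [df [fdf Cdf]]]; split; first exact: eq_cts_on cf.
exists df; split=> // x u Dx.
exact: (eq_dirder hE (cts_on_open cf) fg Dx (fdf x u Dx)).
Qed.

Lemma CnW n E F (D : set E) (f : E -> F) : Cn n.+1 D f -> Cn n D f.
Proof.
elim: n E F D f => [|n IH] E F D f; first by case.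
move=> [cf [df [fdf Cdf]]]; split=> //; exists df; split=> //; exact: IH.
Qed.

Lemma Cn_comp_linear n G E F (D : set E) (f : E -> F) (A : G -> E) :
  linear A -> continuous A -> Cn n D f -> Cn n (A @^-1` D) (fun x => f (A x)).
Proof.
elim: n G E F D f A => [|n IH] G E F D f A lA cA; first exact: cts_on_compr.
move=> [cf [df [fdf Cdf]]]; split; first exact: cts_on_compr.
exists (fun z => df (A z.1, A z.2)); split=> [x u /= Dx|].
  have AD t : A (x + t *: u) = A x + t *: A u by rewrite addrC lA addrC.
  rewrite /dirder /=; under eq_fun do rewrite AD.
  exact: fdf.
pose AA (z : kprod G G) : kprod E E := (A z.1, A z.2).
have cAA : continuous (fun z : G * G => (A z.1, A z.2)).
  move=> z; apply: cvg_pair.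
    by apply: (@continuous_comp (G * G)%type G E fst A); [exact: cvg_fst|exact: cA].
  by apply: (@continuous_comp (G * G)%type G E snd A); [exact: cvg_snd|exact: cA].
apply: (IH _ _ _ (cyl D) df AA) => //; last exact: kelley_continuous cAA.
by move=> a z w; congr (_, _); exact: lA.
Qed.

Lemma diffq_curve E F (D : set E) (f : E -> F) (df : kprod E E -> F) x u :
  cgVS E -> scgVS F -> cts_on D f -> cts_on (cyl D) df ->
  (forall x u, D x -> dirder f x u (df (x, u))) -> D x ->
  cts_on [set t : R^o | D (x + t *: u)] (fun t => diffq f df ((x, u), t)).
Proof.
move=> hE hF cf cdf fdf Dx; have oD := cts_on_open cf.
have cq := diffq_cts_on hE (scgVS_cgVS hF) hF cf cdf fdf.
have oL := open_line x u hE oD.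
apply: (cts_on_comp (f := (fun t => ((x, u), t)) : R^o -> kprod (kprod E E) R^o) _ cq).
  apply: cts_on_kpair; [exact: R_cg|exact: cts_on_cst|exact: cts_on_id].
by move=> t.
Qed.

#[global] Arguments diffq_curve [E F D f df x] u.

(** [F] is in scgVS, so the difference quotients of both functions are continuous curves
    and can be added; their limits alone could not. *)
Lemma Cn_add n E F (D : set E) (f g : E -> F) : cgVS E -> scgVS F ->
  Cn n D f -> Cn n D g -> Cn n D (fun x => f x + g x).
Proof.
elim: n E D f g => [|n IH] E D f g hE hF.
  by move=> cf cg; apply: cts_onD => //; [exact: scgVS_cgVS|exact: cgVS_cg].
move=> [cf [df [fdf Cdf]]] [cg [dg [gdg Cdg]]]; split.
  by apply: cts_onD => //; [exact: scgVS_cgVS|exact: cgVS_cg].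
exists (fun z => df z + dg z); split=> [x u Dx|]; last by apply: IH => //; exact: cgVS_kprod.
have c1 := diffq_curve u hE hF cf (Cn_cts Cdf) fdf Dx.
have c2 := diffq_curve u hE hF cg (Cn_cts Cdg) gdg Dx.
have := @dirder_curve _ _ _ (fun x => f x + g x) x u _ _
  (cts_onD (scgVS_cgVS hF) (R_cg R) c1 c2).
rewrite /diffq /= eqxx; apply; first by rewrite scale0r addr0.
by move=> t _ t0; rewrite (negbTE t0) -scalerDr opprD addrACA.
Qed.

End Cn.

(** * Iterated exponential law *)

Section ExponentialLaw.
Variables (R : realType) (E F : preTopologicalLmodType R).
Variables (hE : cgVS E) (hF : cgVS F) (sF : scgVS F).
Local Notation L := (Lcg hE hF).
Implicit Types G : preTopologicalLmodType R.

(** The product rule for the evaluation map: the derivative of [g x u] at [(x, u)] in the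
    direction [(y, v)] is [dg (x, y) u + g x v].  Both terms are uncurried maps of
    class n composed with linear rearrangements of the variables. *)
Lemma Cn_uncurry n G (D : set G) (g : G -> L) : cgVS G -> Cn n D g ->
  Cn n (cyl D : set (kprod G E)) (fun z => val (g z.1) z.2).
Proof.
have sL := scgVS_Lcg hE hF sF; have hL := scgVS_cgVS sL.
elim: n G D g => [|n IH] G D g hG Cg.
  apply: cts_on_ev.
  - exact: (kprod_cg (cgVS_hausdorff hG) (cgVS_hausdorff hE)).
  - exact: (cts_on_compr (@kfst _ G E) Cg).
  - apply: cts_on_sub (_ : cts_on setT _) _ _ => //; first exact/cts_onT/ksnd.
    by apply: cyl_open; exact: cts_on_open Cg.
have IHg := IH _ _ _ hG (CnW Cg).
have cev := Cn_cts IHg.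
case: Cg => cg [dg [gdg Cdg]]; split=> //.
have hGE := cgVS_kprod hG hE.
exists (fun z => val (dg (z.1.1, z.2.1)) z.1.2 + val (g z.1.1) z.2.2); split.
  move=> [x u] [y v] Dx.
  have cc := diffq_curve y hG sL cg (Cn_cts Cdg) gdg Dx.
  have oO := cts_on_open cc.
  have c1 : cts_on [set t : R^o | D (x + t *: y)]
      (fun t => val (diffq g dg ((x, y), t)) (u + t *: v)).
    by apply: cts_on_ev => //; [exact: R_cg|exact: cts_line].
  have c2 := cts_onD hF (R_cg R) c1 (cts_on_cst (val (g x) v) oO).
  rewrite -[u in val _ u](addr0 u) -(scale0r v).
  have -> : dg (x, y) = diffq g dg ((x, y), 0) by rewrite /diffq /= eqxx.
  apply: (dirder_curve c2); first by rewrite /= scale0r addr0.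
  move=> t _ t0; rewrite /diffq /= (negbTE t0).
  have -> : val (t^-1 *: (g (x + t *: y) - g x)) (u + t *: v) =
    t^-1 *: (val (g (x + t *: y)) (u + t *: v) - val (g x) (u + t *: v)) by [].
  have -> : val (g x) (u + t *: v) = val (g x) u + t *: val (g x) v.
    by rewrite addrC Lcg_linear addrC.
  by rewrite opprD addrA scalerBr scalerA mulVf// scale1r subrK.
have hs := cgVS_kprod hGE hGE.
apply: Cn_add => //.
  have hGG := cgVS_kprod hG hG.
  have IHd := IH _ _ _ hGG Cdg.
  apply: (Cn_comp_linear (A := (fun z => ((z.1.1, z.2.1), z.1.2)) :
    kprod (kprod G E) (kprod G E) -> kprod (kprod G G) E) _ _ IHd) => //.
  apply/cts_onT; apply: cts_on_kpair; first exact: cgVS_cg.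
    apply: cts_on_kpair; first exact: cgVS_cg.
      by apply: (cts_on_compl (@kfst _ G E)); apply/cts_onT/kfst.
    by apply: (cts_on_compl (@kfst _ G E)); apply/cts_onT/ksnd.
  by apply: (cts_on_compl (@ksnd _ G E)); apply/cts_onT/kfst.
apply: (Cn_comp_linear (A := (fun z => (z.1.1, z.2.2)) :
    kprod (kprod G E) (kprod G E) -> kprod G E) _ _ IHg) => //.
apply/cts_onT; apply: cts_on_kpair; first exact: cgVS_cg.
  by apply: (cts_on_compl (@kfst _ G E)); apply/cts_onT/kfst.
by apply: (cts_on_compl (@ksnd _ G E)); apply/cts_onT/ksnd.
Qed.

(** The candidate for [dg (x, y)] is the partial derivative of the uncurried map in the
    direction [(y, 0)], a linear map by passage to the limit.  It is the derivative for
    the topology of the space of linear maps because the difference quotients of the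
    uncurried map are jointly continuous in [t] and [u], so that currying them gives a
    continuous curve of linear maps. *)
Lemma Cn_curry n G (D : set G) (g : G -> L) : cgVS G ->
  Cn n (cyl D : set (kprod G E)) (fun z => val (g z.1) z.2) -> Cn n D g.
Proof.
have hL := cgVS_Lcg hE hF.
elim: n G D g => [|n IH] G D g hG Cg.
  exact: (Lcg_curry (cgVS_cg hG) Cg).
have hGE := cgVS_kprod hG hE.
have cg : cts_on D g by exact: (Lcg_curry (cgVS_cg hG) (Cn_cts Cg)).
have oD := cts_on_open cg.
case: Cg => cc [dc [cdc Cdc]]; split=> //.
pose ev (z : kprod G E) : F := val (g z.1) z.2.
have curve x u y : D x -> cts_on [set t : R^o | D (x + t *: y)]
    (fun t => diffq ev dc (((x, u), (y, 0)), t)).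
  move=> Dx.
  exact: (@diffq_curve _ _ _ (cyl D) ev dc (x, u) (y, 0) hGE sF cc (Cn_cts Cdc) cdc Dx).
have ldc x y : D x -> linear (fun u => dc ((x, u), (y, 0))).
  move=> Dx a u v.
  have cl := curve x (a *: u + v) y Dx.
  have cr := cts_onD hF (R_cg R)
    (cts_onZ hF (cts_on_cst a (cts_on_open cl)) (curve x u y Dx)) (curve x v y Dx).
  have := curve_eq0 (cgVS_hausdorff hF) cl cr.
  rewrite /diffq /= eqxx; apply; first by rewrite scale0r addr0.
  move=> t _ t0; rewrite (negbTE t0) /ev /= scaler0 !addr0 !Lcg_linear.
  rewrite scalerA mulrC -scalerA -scalerDr; congr (_ *: _).
  by rewrite scalerBr opprD addrACA.
have cdcu x y : D x -> continuous (fun u => dc ((x, u), (y, 0))).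
  move=> Dx; apply/cts_onT.
  apply: (cts_on_comp (f := (fun u => ((x, u), (y, 0))) :
    E -> kprod (kprod G E) (kprod G E)) _ (Cn_cts Cdc)) => //.
  have cE := cgVS_cg hE.
  apply: cts_on_kpair => //; last exact/cts_on_cst/openT.
  by apply: cts_on_kpair => //; [exact/cts_on_cst/openT|exact/cts_on_id/openT].
have /choice[dg dgP] : forall z : kprod G G, exists l : L,
    D z.1 -> forall u, val l u = dc ((z.1, u), (z.2, 0)).
  move=> [x y]; have [Dx|nDx] := pselect (D x); last by exists 0.
  by exists (mkLcg hE hF (ldc x y Dx) (cdcu x y Dx)).
exists dg; split=> [x y Dx|]; last first.
  apply: IH; first exact: cgVS_kprod.
  have hs := cgVS_kprod (cgVS_kprod hG hG) hE.
  apply: (@eq_Cn _ n (kprod (kprod G G) E) F (cyl (cyl D))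
    (fun z => dc ((z.1.1, z.2), (z.1.2, 0))) _ hs).
    by move=> [[x y] u] Dx; rewrite /= dgP.
  apply: (Cn_comp_linear (A := (fun z => ((z.1.1, z.2), (z.1.2, 0))) :
    kprod (kprod G G) E -> kprod (kprod G E) (kprod G E)) _ _ Cdc) => //.
    move=> a z w; have E0 : (0 : E) = a *: 0 + 0 by rewrite scaler0 addr0.
    exact: (congr1 (pair _) (congr1 (pair _) E0)).
  apply/cts_onT; apply: cts_on_kpair; first exact: cgVS_cg.
    apply: cts_on_kpair; first exact: cgVS_cg.
      by apply: (cts_on_compl (@kfst _ G G)); apply/cts_onT/kfst.
    exact/cts_onT/ksnd.
  apply: cts_on_kpair; first exact: cgVS_cg.
    by apply: (cts_on_compl (@ksnd _ G G)); apply/cts_onT/kfst.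
  exact/cts_on_cst/openT.
have hRE : compactly_generated (kprod R^o E).
  exact: (kprod_cg (@Rhausdorff R) (cgVS_hausdorff hE)).
have cq := diffq_cts_on hGE hF sF cc (Cn_cts Cdc) cdc.
have cq' : @cts_on (kprod R^o E) F [set z | D (x + z.1 *: y)]
    (fun z => diffq ev dc (((x, z.2), (y, 0)), z.1)).
  have oS : open [set z : kprod R^o E | D (x + z.1 *: y)].
    exact: (cyl_open (open_line x y hG oD)).
  have sub (Y : topologicalType) (h : kprod R^o E -> Y) :
      continuous h -> cts_on [set z : kprod R^o E | D (x + z.1 *: y)] h.
    by move=> ch; apply: cts_on_sub (_ : cts_on setT h) oS _ => //; apply/cts_onT.
  apply: (cts_on_comp (f := (fun z => (((x, z.2), (y, 0)), z.1)) :
    kprod R^o E -> kprod (kprod (kprod G E) (kprod G E)) R^o) _ cq) => //.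
  apply: cts_on_kpair => //; last exact/sub/(@kfst _ R^o).
  apply: cts_on_kpair => //; last exact: cts_on_cst.
  by apply: cts_on_kpair => //; [exact: cts_on_cst|exact/sub/(@ksnd _ R^o)].
pose q (t : R^o) : L := diffq g dg ((x, y), t).
have cqL : cts_on [set t : R^o | D (x + t *: y)] q.
  apply: (Lcg_curry (R_cg R) cq') => t u Dt; rewrite /q /diffq /=.
  case: eqVneq => [t0|t0]; first exact: dgP.
  by rewrite /ev /= scaler0 addr0.
have := @dirder_curve _ _ _ g x y _ _ cqL.
rewrite /q /diffq /= eqxx; apply; first by rewrite scale0r addr0.
by move=> t _ t0; rewrite (negbTE t0).
Qed.

End ExponentialLaw.

(** * The two notions of differentiability *)

Section Link.
Variable R : realType.
Implicit Types E F : preTopologicalLmodType R.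

Lemma linear_scale E F (g : E -> F) a u : linear g -> g (a *: u) = a *: g u.
Proof.
move=> lg; have g0 : g 0 = 0.
  by have := lg (-1) 0 0; rewrite scaler0 addr0 scaleN1r addNr.
by rewrite -[a *: u]addr0 lg g0 addr0.
Qed.

(** Points of a line through [x] belong to the open domain near [x]. *)
Lemma is_dirderivE E F (f : pfun E F) x u l :
  cgVS E -> open (dom f) -> dom f x ->
  is_dirderiv f x u l <-> dirder (pval f) x u l.
Proof.
move=> hE oD Dx; have nD := near_line u hE oD Dx.
split=> h W /h.
  move=> hW; have {}hW : \forall t \near (0 : R^o), t != 0 -> dom f (x + t *: u) ->
    W (t^-1 *: (pval f (x + t *: u) - pval f x)) by exact: hW.
  by apply: filterS2 nD hW => t Dt Wt t0; exact: Wt.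
move=> hW; have {}hW : \forall t \near (0 : R^o), t != 0 ->
    W (t^-1 *: (pval f (x + t *: u) - pval f x)) by exact: hW.
by apply: filterS hW => t Wt t0 _; exact: Wt.
Qed.

Lemma variationE E F (f : pfun E F) (df : kprod E E -> F) :
  cgVS E -> cgVS F -> open (dom f) ->
  (forall x u, dom f x -> dirder (pval f) x u (df (x, u))) ->
  variation f = fun z => if `[< dom f z.1 >] then Some (df z) else None.
Proof.
move=> hE hF oD fdf; apply/funext => -[x u]; rewrite /variation /=.
case: (pselect (dom f x)) => [Dx|nDx]; last first.
  by rewrite asboolF ?asboolF// => -[].
have dl : is_dirderiv f x u (df (x, u)) by apply/is_dirderivE => //; exact: fdf.
rewrite asboolT; last by split=> //; exists (df (x, u)).
rewrite asboolT//; congr Some.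
have /is_dirderivE dx := @xgetPex _ 0 _ (ex_intro (fun l => is_dirderiv f x u l) _ dl).
by apply: (dirder_unique (cgVS_hausdorff hF) (dx hE oD Dx)); exact: fdf.
Qed.

Lemma variation_dirder E F (f : pfun E F) x u : cgVS E -> open (dom f) ->
  dom (variation f) (x, u) -> dirder (pval f) x u (pval (variation f) (x, u)).
Proof.
move=> hE oD; rewrite /dom /pval /variation /=; case: asboolP => //= -[Dx ex] _.
by apply/is_dirderivE => //; exact: (@xgetPex _ 0 _ ex).
Qed.

(** The sequence in the definition of the classes of Seip is determined by its first
    term, so it can be replaced by a recursion. *)
Fixpoint iterated_seip (n : nat) (ft : striple R) : Prop :=
  if n is m.+1 then seip_differentiable ft /\ iterated_seip m (seip_variation ft)
  else C0 ft.

Lemma C0E E F (f : pfun E F) :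
  C0 (STriple E F f) <->
  [/\ scgVS E, scgVS F, open (dom f) & cts_on (dom f) (pval f)].
Proof.
by split=> -[/= sE sF oD cf]; split=> //; apply/cts_on_within.
Qed.

(** Limits in [F] are unique, so the variation, which picks a limit wherever one exists,
    agrees over the domain with any function [df] of directional derivatives. *)
Lemma iterated_seipE n E F (f : pfun E F) :
  iterated_seip n (STriple E F f) <->
  [/\ scgVS E, scgVS F, open (dom f) & Cn n (dom f) (pval f)].
Proof.
elim: n E F f => [|n IH] E F f; first exact: C0E.
split=> [[[/C0E[sE sF oD cf] /C0E[sEE _ oV cV] full] /IH[_ _ _ CV]]|].
  have hE := scgVS_cgVS sE.
  have dV : dom (variation f) = cyl (dom f).
    rewrite predeqE => z; split=> [|Dz]; last by apply: full.
    by rewrite /dom /variation /=; case: asboolP => // -[].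
  split=> //; split=> //; exists (pval (variation f)); split=> [x u Dx|].
    by apply: variation_dirder => //; rewrite dV.
  by rewrite -dV.
move=> [sE sF oD /CnS[cf [df [fdf Cdf]]]].
have [hE hF] := (scgVS_cgVS sE, scgVS_cgVS sF).
have VE := variationE hE hF oD fdf.
have sEE := scgVS_kprod sE sE.
have dV : dom (variation f) = cyl (dom f).
  by rewrite VE predeqE => z; rewrite /dom /=; case: asboolP.
have CV : Cn n (dom (variation f)) (pval (variation f)).
  rewrite dV; apply: eq_Cn Cdf; first exact: cgVS_kprod.
  by move=> z Dz; rewrite VE /pval asboolT.
have oV : open (dom (variation f)) by rewrite dV; exact: cyl_open.
split; last by apply/IH.
split; [exact/C0E|apply/C0E; split=> //; exact: Cn_cts CV|].
by move=> z [Dz _]; rewrite /seip_variation /= dV.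
Qed.

Lemma iterated_seip_iter n (ft : striple R) : iterated_seip n ft <->
  (forall i, (i <= n)%N -> C0 (iter i (@seip_variation R) ft)) /\
  (forall i, (i < n)%N -> seip_differentiable (iter i (@seip_variation R) ft)).
Proof.
elim: n ft => [|n IH] ft /=.
  split=> [h|[h _]]; last exact: (h 0%N).
  by split=> // i; rewrite leqn0 => /eqP ->.
split=> [[sd /IH[h0 hd]]|[h0 hd]].
  split=> -[|i] lei; rewrite ?iterSr; [by case: sd|exact: h0|exact: sd|exact: hd].
split; first exact: (hd 0%N).
apply/IH; split=> i lei; rewrite -iterSr; [exact: h0|exact: hd].
Qed.

Lemma DSeip_iter k (ft : striple R) : DSeip k ft <->
  (forall i, le_smooth i k -> C0 (iter i (@seip_variation R) ft)) /\
  (forall i, lt_smooth i k -> seip_differentiable (iter i (@seip_variation R) ft)).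
Proof.
split=> [[s [s0 sE sS]]|[h0 hd]]; last first.
  by exists (fun i => iter i (@seip_variation R) ft); split=> // i /hd.
have lt_le i : lt_smooth i.+1 k -> lt_smooth i k by case: k {s0 sS} => //= n /ltnW.
have le_lt i : le_smooth i.+1 k -> lt_smooth i k by case: k {s0 sS lt_le}.
have lt_le' i : lt_smooth i k -> le_smooth i k by case: k {s0 sS lt_le le_lt} => //= n /ltnW.
have si i : le_smooth i k -> s i = iter i (@seip_variation R) ft.
  elim: i => [_|i IH /le_lt lti]; first exact: sE.
  by rewrite (proj2 (sS i lti)) IH//; exact: lt_le'.
split=> i hi; first by rewrite -si//; exact: s0.
by rewrite -si; [case: (sS i hi)|exact: lt_le'].
Qed.

Lemma DSeip_Fin n (ft : striple R) : DSeip (Fin n) ft <-> iterated_seip n ft.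
Proof. by rewrite DSeip_iter iterated_seip_iter. Qed.

Lemma DSeip_Infty (ft : striple R) : DSeip Infty ft <-> forall n, iterated_seip n ft.
Proof.
rewrite DSeip_iter; split=> [[h0 hd] n|h].
  by apply/iterated_seip_iter; split=> i _; [exact: h0|exact: hd].
split=> i _; first by have /iterated_seip_iter[h0 _] := h i; exact: h0.
by have /iterated_seip_iter[_ hd] := h i.+1; exact: hd.
Qed.

Section Derivative.
Variables (E F : preTopologicalLmodType R) (hE : cgVS E) (hF : cgVS F).
Variables (f : pfun E F).
Local Notation L := (Lcg hE hF).

Lemma secant_domE : U3 f = secant_dom (dom f).
Proof. by []. Qed.

(** Continuity of [f] itself comes from the remainder at [t = 1], as
    [f y = f x + f1 x (y - x) + h (x, y - x, 1)] for fixed [x]; the directional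
    derivatives come from the continuity of the remainder at [t = 0]. *)
Lemma seip_derivative_dirder (f1 : pfun E L) : seip_derivative f f1 ->
  [/\ scgVS E, scgVS F, open (dom f), dom f1 = dom f &
   [/\ cts_on (dom f) (pval f), cts_on (dom f) (pval f1) &
    forall x u, dom f x -> dirder (pval f) x u (val (pval f1 x) u)]].
Proof.
move=> [[sE sF oD] [d1 c1 [h [ch h0 hf]]]]; split=> //.
have oU := secant_dom_open hE oD.
have {}ch : cts_on (secant_dom (dom f)) h by apply/cts_on_within.
have cR := R_cg R; have cE := cgVS_cg hE.
split.
- apply: cts_onI => // x Dx.
  have cs : cts_on (dom f) (fun y : E => h (x, y - x, 1)).
    apply: (cts_on_comp (f := (fun y => ((x, y - x), 1)) :
      E -> kprod (kprod E E) R^o) _ ch); last first.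
      by move=> y Dy; split=> //=; rewrite scale1r subrKC.
    apply: cts_on_kpair => //; last exact: cts_on_cst.
    apply: cts_on_kpair => //; first exact: cts_on_cst.
    by apply: cts_onB => //; [exact: cts_on_id|exact: cts_on_cst].
  have cl : cts_on (dom f) (fun y : E => val (pval f1 x) (y - x)).
    apply: (cts_on_compl (@Lcg_continuous _ _ _ hE hF (pval f1 x))).
    by apply: cts_onB => //; [exact: cts_on_id|exact: cts_on_cst].
  have := cts_onD hF cE (cts_onD hF cE (cts_on_cst (pval f x) oD) cl) cs.
  move=> /(eq_cts_on (g := pval f)) cf; apply: (cts_on_near (cf _)) => // y Dy.
  rewrite -{3}(subrKC x y) -[y - x]scale1r hf ?scale1r//.
  by split=> //=; rewrite scale1r subrKC.
- by rewrite -d1; apply/cts_on_within => //; rewrite d1.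
- move=> x u Dx; have oL := open_line x u hE oD.
  have cs : cts_on [set t : R^o | dom f (x + t *: u)] (fun t => h (x, u, t)).
    apply: (cts_on_comp (f := (fun t => ((x, u), t)) :
      R^o -> kprod (kprod E E) R^o) _ ch) => //.
    by apply: cts_on_kpair => //; [exact: cts_on_cst|exact: cts_on_id].
  have := cts_onD hF cR (cts_on_cst (val (pval f1 x) u) oL) cs.
  have {2}-> : val (pval f1 x) u = val (pval f1 x) u + h (x, u, 0) by rewrite h0// addr0.
  move=> cc; apply: (dirder_curve cc); first by rewrite /= scale0r addr0.
  move=> t Dt t0; rewrite hf//.
  rewrite (linear_scale t u (@Lcg_linear _ _ _ hE hF (pval f1 x))).
  by rewrite -addrA [X in X - _]addrC addrK -scalerDr scalerA mulVf// scale1r.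
Qed.

(** The derivative is obtained by currying [df], and the remainder is the completed
    difference quotient minus [df]. *)
Lemma dirder_seip_derivative (df : kprod E E -> F) :
  scgVS E -> scgVS F -> cts_on (dom f) (pval f) -> cts_on (cyl (dom f)) df ->
  (forall x u, dom f x -> dirder (pval f) x u (df (x, u))) ->
  exists f1 : pfun E L, seip_derivative f f1 /\
    forall x u, dom f x -> val (pval f1 x) u = df (x, u).
Proof.
move=> sE sF cf cdf fdf; have oD := cts_on_open cf.
have cE := cgVS_cg hE.
have cq := diffq_cts_on hE hF sF cf cdf fdf.
have cdfu x : dom f x -> continuous (fun u => df (x, u)).
  move=> Dx; apply/cts_onT.
  apply: (cts_on_comp (f := (fun u => (x, u)) : E -> kprod E E) _ cdf) => //.
  by apply: cts_on_kpair => //; [exact/cts_on_cst/openT|exact/cts_on_id/openT].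
have /choice[g gP] : forall x, exists l : L, dom f x -> forall u, val l u = df (x, u).
  move=> x; have [Dx|nDx] := pselect (dom f x); last by exists 0.
  by exists (mkLcg hE hF (dirder_linear hE hF cq Dx) (cdfu x Dx)).
pose f1 : pfun E L := fun x => if `[< dom f x >] then Some (g x) else None.
have d1 : dom f1 = dom f.
  by rewrite predeqE => x; rewrite {1}/dom /= /f1; case: asboolP.
have f1E x : dom f x -> pval f1 x = g x by move=> Dx; rewrite /pval /f1 asboolT.
have f1P x u : dom f x -> val (pval f1 x) u = df (x, u).
  by move=> Dx; rewrite f1E// gP.
have cf1 : cts_on (dom f) (pval f1) by exact: (Lcg_curry cE cdf f1P).
exists f1; split=> //; split=> //; split=> //.
  by apply/cts_on_within; rewrite d1.
have oU := secant_dom_open hE oD.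
have cX3 := X3_cg hE.
exists (fun z => diffq (pval f) df z - df z.1); split.
- rewrite secant_domE; apply/cts_on_within => //; apply: cts_onB => //.
  have c1 := cts_on_compr (@kfst _ (kprod E E) R^o) cdf.
  by apply: cts_on_sub c1 oU _ => z [].
- by move=> x u Dx; rewrite /diffq /= eqxx subrr.
- move=> x u t [/= Dx Dxt]; rewrite f1P// /diffq /=.
  have lin := dirder_linear hE hF cq Dx.
  rewrite (linear_scale t u lin).
  case: eqVneq => [->|t0]; first by rewrite !scale0r !addr0.
  by rewrite scalerBr scalerA divff// scale1r -[X in _ = _ + X]addrA -opprD subrKC.
Qed.

End Derivative.

Lemma times_cont_diffS n E F (f : pfun E F) :
  times_cont_diff n.+2 f <-> exists (hE : cgVS E) (hF : cgVS F) (f1 : pfun E (Lcg hE hF)),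
    seip_derivative f f1 /\ times_cont_diff n.+1 f1.
Proof. by []. Qed.

(** For the induction step, [f1] has class n as a map into linear maps if and only if the
    variation of [f], which is the uncurried [f1], has class n: this is the iterated
    exponential law. *)
Lemma times_cont_diffE n E F (f : pfun E F) :
  times_cont_diff n.+1 f <->
  [/\ scgVS E, scgVS F, open (dom f) & Cn n.+1 (dom f) (pval f)].
Proof.
elim: n E F f => [|n IH] E F f.
  split=> [[hE [hF [f1 /seip_derivative_dirder[sE sF oD d1 [cf c1 fd]]]]]|].
    split=> //; split=> //; exists (fun z => val (pval f1 z.1) z.2); split=> //.
    exact: (@Cn_uncurry _ _ _ hE hF sF 0 _ _ _ hE c1).
  move=> [sE sF oD [cf [df [fdf cdf]]]].
  have [hE hF] := (scgVS_cgVS sE, scgVS_cgVS sF).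
  have [f1 [sd _]] := dirder_seip_derivative hE hF sE sF cf cdf fdf.
  by exists hE, hF, f1.
rewrite times_cont_diffS; split.
  move=> [hE [hF [f1 [/seip_derivative_dirder[sE sF oD d1 [cf c1 fd]] /IH[_ _ _ C1]]]]].
  split=> //; split=> //; exists (fun z => val (pval f1 z.1) z.2); split=> //.
  by rewrite d1 in C1; exact: (Cn_uncurry sF hE C1).
move=> [sE sF oD /CnS[cf [df [fdf Cdf]]]].
have [hE hF] := (scgVS_cgVS sE, scgVS_cgVS sF).
have [f1 [sd f1P]] := dirder_seip_derivative hE hF sE sF cf (Cn_cts Cdf) fdf.
exists hE, hF, f1; split=> //.
have [_ _ _ d1 _] := seip_derivative_dirder sd.
apply/IH; split=> //; [exact: scgVS_Lcg|by rewrite d1|rewrite d1].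
apply: (Cn_curry sF hE); apply: eq_Cn Cdf; first exact: cgVS_kprod.
by move=> [x u] Dx; rewrite /= f1P.
Qed.

End Link.

Theorem theorem55 (R : realType) (E F : preTopologicalLmodType R)
    (f : pfun E F) (k : smoothness) :
  DSeip k (STriple E F f) <->
  [\/ k = Fin 0 /\ [/\ scgVS E, scgVS F, open (dom f) & pcontinuous f],
      k = Fin 1 /\ cont_diff f,
      exists n : nat, [/\ k = Fin n, (2 <= n)%N & times_cont_diff n f] |
      k = Infty /\ inf_cont_diff f].
Proof.
have tcd n : times_cont_diff n.+1 f <-> iterated_seip n.+1 (STriple E F f).
  by rewrite times_cont_diffE iterated_seipE.
case: k => [n|].
  rewrite DSeip_Fin; split.
    case: n => [|[|n]] h.
    - by apply: Or41.
    - by apply: Or42; split=> //; exact/(tcd 0%N).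
    - by apply: Or43; exists n.+2; split=> //; exact/tcd.
  case=> [[[->]]|[[->] h]|[m [[->]]]|[]] //.
    exact/(tcd 0%N).
  by case: m => [|m] // _ /tcd.
rewrite DSeip_Infty; split=> [h|[[]|[]|[n []]|[_ h]]] //.
  by apply: Or44; split=> // -[|n] // _; exact/tcd.
case=> [|n]; last by apply/tcd; exact: h.
have /tcd[[]] := h 1%N isT; by [].
Qed.
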